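(* Let $a<b$ be real numbers and let $Y:[a,b]\to S_{-1}$ be a function which is continuous in the strong topology of $S_{-1}$. Then there exists $p\in\mathbb N$ such that the function $t\mapsto Y(t)\lozenge W_\sigma(t)$ is $\mathcal H_p'$-valued on $[a,b]$, and $$\int_a^b Y(t)\lozenge W_\sigma(t)\,dt=\lim_{|\Delta|\to 0}\sum_{k=0}^{n-1}Y(t_k)\lozenge\bigl(X_\sigma(t_{k+1})-X_\sigma(t_k)\bigr),$$ where the limit is in the $\mathcal H_p'$ norm, $\Delta: a=t_0<t_1<\cdots<t_n=b$ is a partition of $[a,b]$, and $|\Delta|=\max_{0\le k\le n-1}(t_{k+1}-t_k)$.
   Context: Measure: $\sigma$ is a Borel probability measure on $\mathbb R$, symmetric under $u\mapsto -u$, supported in $[-1/2,1/2]$, and there are distinct numbers $\lambda_0=0,\lambda_1,\lambda_2,\ldots$ in $\pi\mathbb N_0$ such that the functions $e_{\lambda_n}(u)=e^{i\lambda_n u}$, $n\ge 0$, form an orthonormal basis of $\mathbf L_2(d\sigma)$. Its Fourier transform is $\widehat\sigma(t)=\int_{\mathbb R}e^{itu}\,d\sigma(u)$. White noise space: let $\mathcal S$ be the real Schwartz space on $\mathbb R$, $\Omega=\mathcal S'$ its dual with its Borel $\sigma$-algebra, and $P$ the probability measure on $\Omega$ (Bochner–Minlos) with $\int_{\Omega}e^{-i\langle\omega,s\rangle}dP(\omega)=e^{-\|s\|^2_{\mathbf L_2(\mathbb R,dx)}/2}$ for $s\in\mathcal S$. Put $\mathcal W=\mathbf L_2(\Omega,P)$.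 The map $s\mapsto\widetilde s$, $\widetilde s(\omega)=\langle\omega,s\rangle$, extends to an isometry $f\mapsto\widetilde f$ from real $\mathbf L_2(\mathbb R,dx)$ into $\mathcal W$. Let $h_0,h_1,\ldots$ be the Hermite functions (orthonormal basis of $\mathbf L_2(\mathbb R,dx)$) and $Z_n=\widetilde{h_n}$ (i.i.d. $\mathcal N(0,1)$). Chaos basis: let $\ell$ be the set of sequences $\alpha=(\alpha_1,\alpha_2,\ldots)$ in $\mathbb N_0$ with finitely many nonzero entries, $\alpha!=\alpha_1!\alpha_2!\cdots$, $(2\mathbb N)^{\pm\alpha}=\prod_{j\ge1}(2j)^{\pm\alpha_j}$, and let $\mathbf h_0,\mathbf h_1,\ldots$ be the (probabilists') Hermite polynomials. With the Hermite functions enumerated by $k=1,2,\ldots$ (so the $k$-th one is $h_{k-1}$), put $H_\alpha=\prod_{k\ge1}\mathbf h_{\alpha_k}(\widetilde{h_{k-1}})$. These form an orthogonal basis of $\mathcal W$ with $\|H_\alpha\|^2_{\mathcal W}=\alpha!$. Kondratiev spaces: for $k\in\mathbb N$, $\mathcal H_k$ is the Hilbert space of series $\sum_\alpha f_\alpha H_\alpha$ with $\sum_\alpha(\alpha!)^2|f_\alpha|^2(2\mathbb N)^{k\alpha}<\infty$, and $S_1=\bigcap_k\mathcal H_k$. $\mathcal H_k'$ is the Hilbert space of formal series $f=\sum_\alpha f_\alpha H_\alpha$ with $\|f\|_k^2=\sum_\alpha|f_\alpha|^2(2\mathbb N)^{-k\alpha}<\infty$, and $S_{-1}=\bigcup_k\mathcal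 H_k'$ is the inductive limit, the dual of the nuclear space $S_1$; its strong topology is the strong dual topology. The Wick product on $S_{-1}$ is $\bigl(\sum_\alpha f_\alpha H_\alpha\bigr)\lozenge\bigl(\sum_\beta g_\beta H_\beta\bigr)=\sum_\gamma\bigl(\sum_{\alpha+\beta=\gamma}f_\alpha g_\beta\bigr)H_\gamma$. Processes: for $t\in\mathbb R$, $X_\sigma(t)=\sum_{n=0}^\infty\bigl(\int_0^t\widehat\sigma(y-\lambda_n)\,dy\bigr)Z_n$ and $W_\sigma(t)=\sum_{n=0}^\infty\widehat\sigma(t-\lambda_n)Z_n$, both convergent in $\mathcal W$. The integral on the left-hand side is the Riemann integral of an $\mathcal H_p'$-valued function. *)

(* Defs.v *)
From HB Require Import structures.
From mathcomp Require Import all_boot all_order all_algebra finmap.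
From mathcomp Require Import all_classical all_reals all_analysis.
From mathcomp Require Import complex ring lra.
Set Implicit Arguments.
Unset Strict Implicit.
Unset Printing Implicit Defensive.
Import Order.TTheory GRing.Theory Num.Theory.
Import numFieldNormedType.Exports.

Import ComplexField.
Local Open Scope classical_set_scope.
Local Open Scope ring_scope.
Local Open Scope complex_scope.

Section complex_valued.
Context {R : realType}.

Definition expi (x : R) : R[i] := cos x +i* sin x.

Definition Cintegral d (T : measurableType d) (mu : {measure set T -> \bar R})
    (D : set T) (f : T -> R[i]) : R[i] :=
  Rintegral mu D (fun x => complex.Re (f x)) +i* Rintegral mu D (fun x => complex.Im (f x)).

(* Sum of an absolutely summable family of complex numbers; the real and
   imaginary parts are each split into positive and negative parts. *)
Definition Rsum (I : choiceType) (x : I -> R) : R :=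
  fine (\esum_(i in [set: I]) (Num.max (x i) 0)%:E)
  - fine (\esum_(i in [set: I]) (Num.max (- x i) 0)%:E).
Definition Csum (I : choiceType) (x : I -> R[i]) : R[i] :=
  Rsum (fun i => complex.Re (x i)) +i* Rsum (fun i => complex.Im (x i)).

Section L2.
Context d (T : measurableType d) (mu : {measure set T -> \bar R}).

Definition normL2sq (f : T -> R[i]) : \bar R :=
  (\int[mu]_x (Normc.normc (f x) ^+ 2)%:E)%E.

Definition inL2 (f : T -> R[i]) : Prop :=
  [/\ measurable_fun [set: T] (fun x => complex.Re (f x)),
      measurable_fun [set: T] (fun x => complex.Im (f x)) &
      (normL2sq f < +oo)%E].

Definition cvgL2 (F : nat -> T -> R[i]) (f : T -> R[i]) : Prop :=
  inL2 f /\ normL2sq (fun x => F n x - f x) @[n --> \oo] --> 0%E.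

(* The functions e n are orthonormal and their finite linear combinations are
   dense in L2(mu). *)
Definition orthonormal_basisL2 (e : nat -> T -> R[i]) : Prop :=
  [/\ forall n, inL2 (e n),
      forall m n, Cintegral mu [set: T] (fun x => e m x * (e n x)^*)
                  = (m == n)%:R &
      forall f, inL2 f -> forall eps : R, 0 < eps ->
        exists (N : nat) (c : nat -> R[i]),
          (normL2sq (fun x => (f x - \sum_(n < N) c n * e n x)%R)
           < eps%:E)%E].
End L2.
End complex_valued.

Section spectral_measure.
Context {R : realType} (sigma : probability (measurableTypeR R) R).

Definition symmetric_measure : Prop :=
  forall A : set R, measurable (A : set (measurableTypeR R)) ->
    sigma [set u | A (- u)] = sigma A.

Definition supported_in (A : set R) : Prop := sigma (~` A) = 0%E.

Definition fourier (t : R) : R[i] :=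
  Cintegral sigma [set: R] (fun u => expi (t * u)).

(* int_0^t of fourier (y - l) dy, with the usual sign convention for t < 0 *)
Definition int_fourier (l t : R) : R[i] :=
  let f := fun y => fourier (y - l) in
  if 0 <= t then Cintegral lebesgue_measure `[0, t] f
  else - Cintegral lebesgue_measure `[t, 0] f.
End spectral_measure.

Section white_noise.
Context (R : realType).

Definition schwartz_pred : {pred R -> R^o} :=
  mem [set f : R -> R^o |
    (forall k x, derivable (derive1n k f) x 1) /\
    (forall m k, exists M : R, forall x, `|x ^+ m * derive1n k f x| <= M)].

Definition schwartz : Type := {f : R -> R^o | f \in schwartz_pred}.
HB.instance Definition _ := [isSub of schwartz for @sval _ _].
HB.instance Definition _ := [Choice of schwartz by <:].

Lemma derive1n_lin k (c : R) (f g : R -> R^o) :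
  (forall k x, derivable (derive1n k f) x 1) ->
  (forall k x, derivable (derive1n k g) x 1) ->
  derive1n k (c *: f + g) = c *: derive1n k f + derive1n k g.
Proof.
move=> df dg; elim: k => [//|k IH].
rewrite !derive1nS IH; apply/funext => x.
rewrite derive1E deriveD//; last exact: derivableZ.
by rewrite deriveZ// -!derive1E.
Qed.

Lemma schwartz_submod_closed : submod_closed schwartz_pred.
Proof.
split.
  have E k : derive1n k (0 : R -> R^o) = 0.
    elim: k => [//|k IH]; rewrite derive1nS IH; apply/funext => x.
    by rewrite derive1_cst.
  rewrite inE; split => [k x|m k]; first by rewrite E; exact: derivable_cst 0 x 1.
  by exists 0 => x; rewrite E mulr0 normr0.
move=> c f g; rewrite !inE => -[df bf] [dg bg]; split => [k x|m k].
  by rewrite derive1n_lin//; apply: derivableD => //; exact: derivableZ.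
have [M hM] := bf m k; have [N hN] := bg m k.
exists (`|c| * M + N) => x; rewrite derive1n_lin// mulrDr.
apply: le_trans (ler_normD _ _) _; apply: lerD; last exact: hN.
rewrite [X in `|X|](_ : _ = c * (x ^+ m * derive1n k f x)).
  by rewrite normrM ler_wpM2l.
by rewrite mulrCA.
Qed.

HB.instance Definition _ := GRing.isSubmodClosed.Build R (R -> R^o)
  schwartz_pred schwartz_submod_closed.
HB.instance Definition _ := [SubChoice_isSubLmodule of schwartz by <:].

(* The Schwartz topology: f_i --> f iff x^m f_i^(k) --> x^m f^(k) uniformly on
   R for all m and k. *)
Definition schwartz_jets (f : schwartz) :
    {ptws nat * nat -> {uniform R -> R^o}} :=
  fun mk => (fun x : R => x ^+ mk.1 * derive1n mk.2 (\val f) x).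
Definition schwartz_space : topologicalType := initial_topology schwartz_jets.

(* The dual of the Schwartz space, with the topology of pointwise convergence
   (weak-star). *)
Definition tempered : set {ptws schwartz -> R^o} :=
  [set w | linear (w : schwartz -> R^o) /\
           continuous (w : schwartz_space -> R^o)].
Definition tempered_space : Type := set_type tempered.
HB.instance Definition _ := Topological.on tempered_space.

Lemma tempered0 : tempered (fun _ => 0).
Proof.
split; first by move=> c f g; rewrite scaler0 addr0.
by move=> f; exact: cst_continuous.
Qed.

HB.instance Definition _ := isPointed.Build tempered_space
  (SigSub (mem_set tempered0)).

Definition Omega : measurableType _ :=
  g_sigma_algebraType (@open tempered_space).
Definition pairing (w : Omega) (s : schwartz) : R :=
  (\val (w : tempered_space)) s.

Definition white_noise_measure (P : probability Omega R) : Prop :=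
  forall s : schwartz,
    Cintegral P [set: Omega] (fun w => expi (- pairing w s))
    = (expR (- (Rintegral lebesgue_measure [set: R]
                  (fun x => (\val s x) ^+ 2)) / 2))%:C.

(* probabilists' Hermite polynomials *)
Fixpoint hermite_poly (n : nat) : {poly R} :=
  if n is m.+1 then 'X * hermite_poly m - (hermite_poly m)^`() else 1.

Definition gauss_poly (q : {poly R}) : R -> R^o :=
  fun x => expR (- x ^+ 2 / 2) * q.[x].

Lemma is_derive_gauss_poly q (x : R) :
  is_derive x (1 : R) (gauss_poly q) (gauss_poly (q^`() - 'X * q) x).
Proof.
rewrite /gauss_poly.
apply: is_derive_eq.
rewrite !hornerE /GRing.scale /=.
by field.
Qed.

Lemma pow_expR_le (n : nat) (x : R) :
  `|x| ^+ n * expR (- x ^+ 2 / 2) <= 1 + 2 ^+ n * n`!%:R.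
Proof.
have y0 : 0 <= x ^+ 2 / 2 by rewrite divr_ge0// sqr_ge0.
have e1 : expR (- x ^+ 2 / 2) <= 1.
  by rewrite -[leRHS]expR0 ler_expR mulNr oppr_le0.
have h : (x ^+ 2 / 2) ^+ n <= n`!%:R * expR (x ^+ 2 / 2).
  case: n => [|n]; first by rewrite expr0 mul1r -[leLHS]expR0 ler_expR.
  rewrite -ler_pdivrMl ?ltr0n ?fact_gt0// mulrC.
  by apply: le_trans (expR_ge1Dxn n y0); rewrite lerDr.
have k : `|x| ^+ n <= 1 + `|x| ^+ n ^+ 2.
  have : 0 <= `|x| ^+ n by rewrite exprn_ge0.
  by move: (`|x| ^+ n) => t t0; have := sqr_ge0 (t - 1); rewrite sqrrB; nra.
apply: (@le_trans _ _ ((1 + `|x| ^+ n ^+ 2) * expR (- x ^+ 2 / 2))).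
  by rewrite ler_wpM2r// expR_ge0.
rewrite mulrDl mul1r lerD// -exprM mulnC exprM real_normK ?num_real//.
rewrite mulNr expRN ler_pdivrMr ?expR_gt0//.
rewrite -mulrA (le_trans _ (ler_wpM2l _ h)) ?exprn_ge0//.
by rewrite -exprMn mulrCA divff// mulr1.
Qed.

Lemma gauss_poly_bounded q : exists M : R, forall x, `|gauss_poly q x| <= M.
Proof.
exists (\sum_(i < size q) `|q`_i| * (1 + 2 ^+ i * i`!%:R)) => x.
rewrite /gauss_poly horner_coef mulr_sumr.
apply: le_trans (ler_norm_sum _ _ _) _; apply: ler_sum => i _.
rewrite mulrCA !normrM ler_wpM2l// normrX mulrC.
by rewrite (ger0_norm (expR_ge0 _)); exact: pow_expR_le.
Qed.

Lemma derive1n_gauss_poly k q :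
  derive1n k (gauss_poly q) = gauss_poly (iter k (fun r => r^`() - 'X * r) q).
Proof.
elim: k => [//|k IH]; rewrite derive1nS IH; apply/funext => x /=.
by rewrite derive1E; have [_ ->] := is_derive_gauss_poly
  (iter k (fun r => r^`() - 'X * r) q) x.
Qed.

Lemma schwartz_gauss_poly q : gauss_poly q \in schwartz_pred.
Proof.
rewrite inE; split => [k x|m k]; rewrite derive1n_gauss_poly.
  by have [] := is_derive_gauss_poly (iter k (fun r => r^`() - 'X * r) q) x.
set r := iter _ _ _.
have [M hM] := gauss_poly_bounded ('X^m * r); exists M => x.
by rewrite mulrCA; have := hM x; rewrite /gauss_poly hornerM hornerXn.
Qed.

(* h_n (x) = pi^(-1/4) (n!)^(-1/2) e^(-x^2/2) He_n (sqrt 2 x) *)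
Definition hermite_fun (n : nat) : R -> R^o :=
  fun x => (Num.sqrt (Num.sqrt pi * n`!%:R))^-1 * expR (- x ^+ 2 / 2)
           * (hermite_poly n).[Num.sqrt 2 * x].

Lemma schwartz_hermite_fun n : hermite_fun n \in schwartz_pred.
Proof.
set c : R := (Num.sqrt (Num.sqrt pi * n`!%:R))^-1.
rewrite (_ : hermite_fun n = gauss_poly
  (c *: (hermite_poly n \Po (Num.sqrt 2 *: 'X)))).
  exact: schwartz_gauss_poly.
apply/funext => x; rewrite /hermite_fun /gauss_poly hornerZ horner_comp.
by rewrite hornerZ hornerX mulrCA mulrA.
Qed.

Definition hermite_schwartz (n : nat) : schwartz :=
  Sub (hermite_fun n) (schwartz_hermite_fun n).

Definition Z (n : nat) (w : Omega) : R := pairing w (hermite_schwartz n).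
End white_noise.

Section chaos.
Context {R : realType}.

(* Entry k of a multi-index is alpha_(k+1) in the usual numbering from 1. *)
Definition mindex : choiceType := {fsfun nat -> nat with 0%N}.

Definition mfact (al : mindex) : nat := (\prod_(k <- finsupp al) (al k)`!)%N.

Definition evens_pow (al : mindex) : nat :=
  (\prod_(k <- finsupp al) (2 * k.+1) ^ al k)%N.

Definition Hchaos (al : mindex) (w : Omega R) : R :=
  \prod_(k <- finsupp al) (hermite_poly R (al k)).[Z k w].

Definition fseries := mindex -> R[i].

(* The formal series sum_al f_al H_al of an element F of L2(P), its
   coefficients with respect to the orthogonal basis (H_al). *)
Definition chaos_series (P : probability (Omega R) R) (F : Omega R -> R[i]) :
    fseries :=
  fun al => Cintegral P [set: Omega R] (fun w => F w * (Hchaos al w)%:C)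
            / (mfact al)%:R.

(* Squared norm of H_k, with value +oo outside H_k. *)
Definition test_normsq (k : nat) (f : fseries) : \bar R :=
  \esum_(al in [set: mindex])
    ((mfact al)%:R ^+ 2 * Normc.normc (f al) ^+ 2 * (evens_pow al)%:R ^+ k)%:E.

(* Squared norm of H_k', with value +oo outside H_k'. *)
Definition dual_normsq (k : nat) (f : fseries) : \bar R :=
  \esum_(al in [set: mindex])
    (Normc.normc (f al) ^+ 2 * (evens_pow al)%:R ^- k)%:E.

Definition in_H (k : nat) : set fseries := [set f | (test_normsq k f < +oo)%E].
Definition in_Hdual (k : nat) : set fseries :=
  [set f | (dual_normsq k f < +oo)%E].

Definition S1 : set fseries := \bigcap_(k in [set k | (0 < k)%N]) in_H k.
Definition Sm1 : set fseries := \bigcup_(k in [set k | (0 < k)%N]) in_Hdual k.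

(* Bounded subsets of the Frechet space S1. *)
Definition S1_bounded (B : set fseries) : Prop :=
  B `<=` S1 /\
  forall k, (0 < k)%N ->
    exists M : R, forall phi, B phi -> (test_normsq k phi <= M%:E)%E.

(* The (bilinear) duality between Sm1 and S1, extending that of L2(P). *)
Definition duality (f phi : fseries) : R[i] :=
  Csum (fun al => (mfact al)%:R * f al * phi al).

(* An element of Sm1 as a functional, in the topology of uniform convergence
   on the bounded subsets of S1. *)
Definition strong_dual (f : fseries) :
  {family S1_bounded, fseries -> R[i]^o} := fun phi => duality f phi.

Definition wick (f g : fseries) : fseries := fun ga =>
  \sum_(ab \in [set ab : mindex * mindex |
                  forall k, (ab.1 k + ab.2 k)%N = ga k]) f ab.1 * g ab.2.

Definition is_Xsigma (sigma : probability (measurableTypeR R) R)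
    (lam : nat -> R) (P : probability (Omega R) R)
    (X : R -> Omega R -> R[i]) : Prop :=
  forall t : R, cvgL2 P
    (fun N w => \sum_(n < N) int_fourier sigma (lam n) t * (Z n w)%:C) (X t).

Definition is_Wsigma (sigma : probability (measurableTypeR R) R)
    (lam : nat -> R) (P : probability (Omega R) R)
    (W : R -> Omega R -> R[i]) : Prop :=
  forall t : R, cvgL2 P
    (fun N w => \sum_(n < N) fourier sigma (t - lam n) * (Z n w)%:C) (W t).
End chaos.

Section integrals.
Context {R : realType}.

(* The partition a = t_0 < ... < t_n = b is given by the sequence
   s = [:: t_1; ...; t_n]. *)
Definition node (a : R) (s : seq R) (k : nat) : R := nth a (a :: s) k.

Definition mesh (a : R) (s : seq R) : R :=
  \big[Num.max/0]_(k < size s) (node a s k.+1 - node a s k).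

Definition is_Riemann_integral (p : nat) (F : R -> fseries) (a b : R)
    (I : fseries) : Prop :=
  forall eps : R, 0 < eps -> exists2 delta : R, 0 < delta &
    forall (s : seq R) (xi : nat -> R),
      itv_partition a b s -> mesh a s < delta ->
      (forall k, (k < size s)%N -> node a s k <= xi k <= node a s k.+1) ->
      (dual_normsq p ((\sum_(k < size s)
          (fun al => (node a s k.+1 - node a s k)%:C * F (xi k) al)%R) - I)%R
        < (eps ^+ 2)%:E)%E.

Definition is_mesh_limit (p : nat) (a b : R) (S : seq R -> fseries)
    (I : fseries) : Prop :=
  forall eps : R, 0 < eps -> exists2 delta : R, 0 < delta &
    forall s : seq R, itv_partition a b s -> mesh a s < delta ->
      (dual_normsq p (S s - I)%R < (eps ^+ 2)%:E)%E.
End integrals.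

(* Main.v *)
Require Import Defs.
From mathcomp Require Import all_boot all_order all_algebra finmap.
From mathcomp Require Import all_classical all_reals all_analysis.
From mathcomp Require Import measurable_realfun complex ring lra.
Set Implicit Arguments.
Unset Strict Implicit.
Unset Printing Implicit Defensive.
Import Order.TTheory GRing.Theory Num.Theory.
Import numFieldNormedType.Exports.
Import Normc.
Local Open Scope classical_set_scope.
Local Open Scope ring_scope.

(** Everything happens at the level of chaos coefficients. The two processes are
    L2-convergent series [sum_n c_n Z_n], and a formal series supported on the
    multi-indices of degree one is all that remains of them
    ([chaos_series_linear]). This uses that each [Z_n] is orthogonal to every
    [H_al] other than itself, a fact that has to come out of the characteristic
    functional of the white noise: the functional determines the Gaussian moments
    ([standard_normal_moments]) and, by differentiation, gives Gaussian integration
    by parts ([stein]), which computes [E (Z_n H_al)] ([mean_Z_Hchaos]).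

    On the analytic side there are three facts.

    A strongly continuous path in the inductive limit over a compact interval
    stays in a bounded part of one [H_k'] ([strong_continuous_bounded]). Otherwise
    there are test elements [phi_k] of norm at most one in [H_k] on which values of
    the path have modulus [k]; together they form a bounded set of test
    elements, on which a continuous path is bounded. On a bounded part of [H_k']
    the next norm is controlled by finitely many coefficients up to a small error,
    so the path is uniformly continuous in [H_(k+1)'] ([strong_continuous_uniform]).

    For [p >= 2], Wick multiplication by a series of degree one [g] is bounded on
    [H_p'], with norm at most the l2 norm of [g] ([dnorm_le_wick]): the weights
    [(2 n)^(-p)] gained by lowering a multi-index have sum at most one.

    The l2 norm of the coefficients of [W_sigma t] and of the differences
    [W_sigma t - W_sigma s] is estimated by Bessel's inequality in [L2(sigma)]. As
    [sigma] lives on a bounded set, [W_sigma] is Lipschitz; as it is the derivative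
    of [X_sigma] coordinate by coordinate, the mean value inequality gives
    [X(t) - X(s) = (t - s) W(s) + O((t - s)^2)] ([dnorm_X_coef_linearization]).

    Thus [Y * W] is uniformly continuous in one [H_p'], where its coordinatewise
    primitive is its Riemann integral, and exchanging [(t_(k+1) - t_k) W(t_k)] with
    [X(t_(k+1)) - X(t_k)] in a Riemann sum costs at most
    [sup |Y| * mesh * (b - a)] ([wick_integral]). *)

(** * Complex modulus and the Cauchy-Schwarz inequality *)
Section complex_norm.
Context {R : realType}.
Implicit Types x y z : R[i].

Lemma normc_sq z : normc z ^+ 2 = complex.Re z ^+ 2 + complex.Im z ^+ 2.
Proof. by case: z => u v /=; rewrite sqr_sqrtr// addr_ge0// sqr_ge0. Qed.

Lemma normc_ge0 z : 0 <= normc z.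
Proof. by case: z => u v; exact: sqrtr_ge0. Qed.

Lemma normcE z : `|z| = (normc z)%:C%C.
Proof. by case: z. Qed.

Lemma ler_normcD x y : normc (x + y) <= normc x + normc y.
Proof. by rewrite -lecR rmorphD /= -!normcE; exact: ler_normD. Qed.

Lemma normcN z : normc (- z) = normc z.
Proof. by case: z => u v /=; rewrite !sqrrN. Qed.

Lemma normc_real (u : R) : normc (u%:C)%C = `|u|.
Proof. by rewrite /= expr0n addr0 sqrtr_sqr. Qed.

Lemma normc_ge_Re (z : R[i]) : `|complex.Re z| <= normc z.
Proof.
rewrite -(@ler_pXn2r _ 2)// ?nnegrE ?normc_ge0// real_normK ?num_real//.
by rewrite normc_sq lerDl sqr_ge0.
Qed.

Lemma normc_ge_Im (z : R[i]) : `|complex.Im z| <= normc z.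
Proof.
rewrite -(@ler_pXn2r _ 2)// ?nnegrE ?normc_ge0// real_normK ?num_real//.
by rewrite normc_sq lerDr sqr_ge0.
Qed.

Lemma complex_eta (z : R[i]) : z = (complex.Re z +i* complex.Im z)%C.
Proof. by case: z. Qed.

Lemma ler_normc_sum (I : Type) (r : seq I) (F : I -> R[i]) :
  normc (\sum_(i <- r) F i) <= \sum_(i <- r) normc (F i).
Proof.
elim/big_ind2 : _ => //; first by rewrite normc0.
by move=> a b c d h k; apply: le_trans (ler_normcD _ _) _; exact: lerD.
Qed.

(** By induction on the summands: when a summand [x y] joins sums with
    [c^2 <= p q], the cross term [2 c x y] is at most [p y^2 + q x^2]. *)
Lemma cauchy_schwarz_sum (I : Type) (r : seq I) (a b : I -> R) :
  (\sum_(i <- r) a i * b i) ^+ 2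
    <= (\sum_(i <- r) a i ^+ 2) * (\sum_(i <- r) b i ^+ 2).
Proof.
elim: r => [|i r IH]; first by rewrite !big_nil expr0n mul0r.
rewrite !big_cons.
have p0 : 0 <= \sum_(i <- r) a i ^+ 2 by apply: sumr_ge0 => j _; exact: sqr_ge0.
have q0 : 0 <= \sum_(i <- r) b i ^+ 2 by apply: sumr_ge0 => j _; exact: sqr_ge0.
move: IH p0 q0.
set c := \sum_(i <- r) _; set p := \sum_(i <- r) _; set q := \sum_(i <- r) _.
move: (a i) (b i) c p q => x y c p q IH p0 q0.
have h : 2 * (c * (x * y)) <= p * y ^+ 2 + q * x ^+ 2.
  have h0 : 0 <= p * y ^+ 2 + q * x ^+ 2.
    by rewrite addr_ge0// mulr_ge0// sqr_ge0.
  apply: le_trans (ler_norm _) _.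
  rewrite -(@ler_pXn2r _ 2)// ?nnegrE//.
  rewrite real_normK ?num_real//.
  have : (p * y ^+ 2 - q * x ^+ 2) ^+ 2 >= 0 by exact: sqr_ge0.
  have : c ^+ 2 * (x * y) ^+ 2 <= p * q * (x * y) ^+ 2.
    by rewrite ler_wpM2r// sqr_ge0.
  nra.
nra.
Qed.

End complex_norm.

(** * The dual norms on formal series *)
Section dual_norm.
Context {R : realType}.
Local Notation fseries := (@fseries R).
Implicit Types (f g : fseries) (p : nat).

Definition weight p (al : mindex) : R := (evens_pow al)%:R ^- p.

(** The norm of [H_p'] is at most [M], said with finite partial sums: this keeps
    the estimates within the reals and free of summability side conditions. *)
Definition dnorm_le p f (M : R) :=
  forall F : {fset mindex},
    \sum_(al <- F) normc (f al) ^+ 2 * weight p al <= M ^+ 2.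

Lemma evens_pow_gt0 al : (0 < evens_pow al)%N.
Proof. by rewrite /evens_pow prodn_gt0// => i; rewrite expn_gt0. Qed.

Lemma evens_pow_ge1 al : 1 <= (evens_pow al)%:R :> R.
Proof. by rewrite ler1n evens_pow_gt0. Qed.

Lemma weight_gt0 p al : 0 < weight p al.
Proof. by rewrite /weight invr_gt0 exprn_gt0// ltr0n evens_pow_gt0. Qed.

Lemma weight_ge0 p al : 0 <= weight p al.
Proof. exact/ltW/weight_gt0. Qed.

Lemma dnorm_term_ge0 p f al : 0 <= normc (f al) ^+ 2 * weight p al.
Proof. by rewrite mulr_ge0 ?sqr_ge0// weight_ge0. Qed.

Lemma dual_normsq_le p f M :
  (dual_normsq p f <= (M ^+ 2)%:E)%E <-> dnorm_le p f M.
Proof.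
rewrite /dual_normsq /esum; split=> [h F|h].
  rewrite -lee_fin; apply: le_trans h.
  rewrite -sumEFin fsbig_seq//.
  apply: ereal_sup_ubound => /=; exists [set` F] => //.
apply: ge_ereal_sup => _ [A [finA _]] <-.
rewrite fsbig_finite// sumEFin lee_fin.
exact: h.
Qed.

Lemma dnorm_le_in_Hdual p f M : dnorm_le p f M -> in_Hdual p f.
Proof.
by move=> /(dual_normsq_le _ _ _).2 h; apply: le_lt_trans h _; rewrite ltry.
Qed.

Lemma in_Hdual_dnorm_le p f : in_Hdual p f -> exists2 M, 0 <= M & dnorm_le p f M.
Proof.
rewrite /in_Hdual /= => h.
have h0 : (0 <= dual_normsq p f)%E.
  by apply: esum_ge0 => al _; rewrite lee_fin dnorm_term_ge0.
exists (Num.sqrt (fine (dual_normsq p f))); first exact: sqrtr_ge0.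
apply/dual_normsq_le; rewrite sqr_sqrtr ?fine_ge0//.
by rewrite fineK// ge0_fin_numE.
Qed.

Lemma dnorm_le_mono p f M N : 0 <= M -> M <= N -> dnorm_le p f M -> dnorm_le p f N.
Proof.
move=> M0 MN h F; apply: le_trans (h F) _.
by rewrite ler_pXn2r// nnegrE// (le_trans M0).
Qed.

Lemma dnorm_le_succ p f M : dnorm_le p f M -> dnorm_le p.+1 f M.
Proof.
move=> h F; apply: le_trans (h F); apply: ler_sum => al _.
rewrite ler_wpM2l ?sqr_ge0// /weight lef_pV2 ?posrE ?exprn_gt0 ?ltr0n ?evens_pow_gt0//.
by rewrite exprS ler_peMl ?exprn_ge0// evens_pow_ge1.
Qed.

Lemma dnorm_le_coord p f M al : 0 <= M -> dnorm_le p f M ->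
  normc (f al) * Num.sqrt (weight p al) <= M.
Proof.
move=> M0 h; rewrite -(@ler_pXn2r _ 2)// ?nnegrE ?mulr_ge0 ?normc_ge0 ?sqrtr_ge0//.
rewrite exprMn sqr_sqrtr ?weight_ge0//.
by have := h [fset al]%fset; rewrite big_seq_fset1.
Qed.

Lemma dnorm_le0 p : dnorm_le p (0 : fseries) 0.
Proof.
by move=> F; rewrite big1// ?expr0n// => al _; rewrite normc0 expr0n mul0r.
Qed.

(** Minkowski's inequality. *)
Lemma dnorm_leD p f g M N : 0 <= M -> 0 <= N ->
  dnorm_le p f M -> dnorm_le p g N -> dnorm_le p (f + g) (M + N).
Proof.
move=> M0 N0 hf hg F.
pose u al := Num.sqrt (weight p al) * normc (f al).
pose v al := Num.sqrt (weight p al) * normc (g al).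
have uE al : normc (f al) ^+ 2 * weight p al = u al ^+ 2.
  by rewrite /u exprMn sqr_sqrtr ?weight_ge0// mulrC.
have vE al : normc (g al) ^+ 2 * weight p al = v al ^+ 2.
  by rewrite /v exprMn sqr_sqrtr ?weight_ge0// mulrC.
have {hf} := hf F; under eq_bigr do rewrite uE; move=> hf.
have {hg} := hg F; under eq_bigr do rewrite vE; move=> hg.
have uv : \sum_(al <- F) u al * v al <= M * N.
  apply: le_trans (ler_norm _) _.
  rewrite -(@ler_pXn2r _ 2)// ?nnegrE// ?mulr_ge0//.
  rewrite real_normK ?num_real//.
  apply: le_trans (cauchy_schwarz_sum _ _ _) _.
  by rewrite exprMn ler_pM// sumr_ge0// => i _; exact: sqr_ge0.
apply: (@le_trans _ _ (\sum_(al <- F) (u al + v al) ^+ 2)).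
  apply: ler_sum => al _.
  rewrite -[weight p al]sqr_sqrtr ?weight_ge0// -exprMn.
  rewrite ler_pXn2r// ?nnegrE.
  - by rewrite -mulrDr mulrC ler_wpM2l ?sqrtr_ge0// ler_normcD.
  - by rewrite mulr_ge0 ?normc_ge0 ?sqrtr_ge0.
  - by rewrite addr_ge0// mulr_ge0 ?normc_ge0 ?sqrtr_ge0.
under eq_bigr do rewrite sqrrD.
rewrite !big_split /=; nra.
Qed.

Lemma dnorm_leN p f M : dnorm_le p f M -> dnorm_le p (- f) M.
Proof. by move=> h F; under eq_bigr do rewrite normcN. Qed.

Lemma dnorm_leB p f g M N : 0 <= M -> 0 <= N ->
  dnorm_le p f M -> dnorm_le p g N -> dnorm_le p (f - g) (M + N).
Proof. by move=> M0 N0 hf hg; apply: dnorm_leD => //; exact: dnorm_leN. Qed.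

Lemma dnorm_le_sum p n (f : 'I_n -> fseries) (M : 'I_n -> R) :
  (forall k, 0 <= M k) -> (forall k, dnorm_le p (f k) (M k)) ->
  dnorm_le p (\sum_k f k) (\sum_k M k).
Proof.
move=> M0 h.
suff [] : 0 <= \sum_k M k /\ dnorm_le p (\sum_k f k) (\sum_k M k) by [].
elim/big_ind2 : _ => //; first by split => //; exact: dnorm_le0.
move=> a b c d [? ?] [? ?]; split; first exact: addr_ge0.
exact: dnorm_leD.
Qed.

Lemma is_derive_sum_seq (I : Type) (r : seq I) (f : I -> R -> R) (df : I -> R)
    (x : R) :
  (forall i, is_derive x (1 : R) (f i) (df i)) ->
  is_derive x (1 : R) (fun y => \sum_(i <- r) f i y) (\sum_(i <- r) df i).
Proof.
move=> h; elim: r => [|i r IH].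
  under eq_fun do rewrite big_nil.
  by rewrite big_nil; exact: is_derive_cst.
under eq_fun do rewrite big_cons.
by rewrite big_cons; exact: is_deriveD.
Qed.

(** A mean value inequality that only needs coordinatewise derivatives. Pairing
    finitely many coordinates with the increment [d] itself turns it into the mean
    value theorem for one real function, [phi]. *)
Lemma dnorm_le_increment p (G F : R -> fseries) (v : fseries) (s t e : R) :
  s <= t -> 0 <= e ->
  (forall al x, x \in `[s, t] ->
     is_derive x (1 : R) (fun y => complex.Re (G y al)) (complex.Re (F x al))) ->
  (forall al x, x \in `[s, t] ->
     is_derive x (1 : R) (fun y => complex.Im (G y al)) (complex.Im (F x al))) ->
  (forall x, x \in `[s, t] -> dnorm_le p (F x - v) e) ->
  dnorm_le p (G t - G s - (fun al => ((t - s)%:C)%C * v al)) (e * (t - s)).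
Proof.
move=> st e0 dRe dIm hv A.
set d : fseries := G t - G s - _.
pose phi (y : R) := \sum_(al <- A) weight p al *
   (complex.Re (d al) * (complex.Re (G y al) - y * complex.Re (v al))
  + complex.Im (d al) * (complex.Im (G y al) - y * complex.Im (v al))).
pose phi' (y : R) := \sum_(al <- A) weight p al *
   (complex.Re (d al) * complex.Re (F y al - v al)
  + complex.Im (d al) * complex.Im (F y al - v al)).
have dterm al y : y \in `[s, t] -> is_derive y (1 : R) (fun y => weight p al *
   (complex.Re (d al) * (complex.Re (G y al) - y * complex.Re (v al))
  + complex.Im (d al) * (complex.Im (G y al) - y * complex.Im (v al))))
  (weight p al *
   (complex.Re (d al) * complex.Re (F y al - v al)
  + complex.Im (d al) * complex.Im (F y al - v al))).
  move=> yst; have := dRe al y yst; have := dIm al y yst => *.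
  rewrite (raddfB (@complex.Re R) (F y al)) (raddfB (@complex.Im R) (F y al)).
  apply: is_derive_eq; rewrite /GRing.scale /=; ring.
have dphi y : y \in `[s, t] -> is_derive y (1 : R) phi (phi' y).
  by move=> yst; apply: is_derive_sum_seq => al; exact: dterm.
have [c cst phiE] : exists2 c, c \in `[s, t] & phi t - phi s = phi' c * (t - s).
  have H := @MVT_segment R phi phi' s t st
    (fun x xst => dphi x (subset_itv_oo_cc xst)).
  apply: H; apply: derivable_within_continuous => x xst.
  by have [] := dphi x xst.
have phiD : phi t - phi s = \sum_(al <- A) normc (d al) ^+ 2 * weight p al.
  rewrite /phi -sumrB; apply: eq_bigr => al _.
  rewrite normc_sq.
  have -> : complex.Re (d al) = complex.Re (G t al) - complex.Re (G s al) - (t - s) * complex.Re (v al).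
    by rewrite /d /= !(raddfB,raddfN,raddfD) /=; case: (v al) => x y /=; ring.
  have -> : complex.Im (d al) = complex.Im (G t al) - complex.Im (G s al) - (t - s) * complex.Im (v al).
    by rewrite /d /= !(raddfB,raddfN,raddfD) /=; case: (v al) => x y /=; ring.
  ring.
set D := \sum_(al <- A) normc (d al) ^+ 2 * weight p al in phiD *.
set E := \sum_(al <- A) normc (F c al - v al) ^+ 2 * weight p al.
have hE : E <= e ^+ 2 by exact: hv.
have ts0 : 0 <= t - s by rewrite subr_ge0.
(* [2 <d, (t - s) (F c - v)> <= |d|^2 + (t - s)^2 |F c - v|^2] in the weighted
   inner product, and the left-hand side is [2 |d|^2] *)
have h : 2 * (phi' c * (t - s)) <= D + (t - s) ^+ 2 * E.
  rewrite (mulrC (phi' c)) mulrA /phi' /D /E !mulr_sumr -big_split /=.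
  apply: ler_sum => al _.
  rewrite !normc_sq.
  move: (weight p al) (weight_ge0 p al) => w w0.
  move: (complex.Re (d al)) (complex.Im (d al)) => x y.
  move: (complex.Re (F c al - _)) (complex.Im (F c al - _)) => x' y'.
  have := mulr_ge0 w0 (sqr_ge0 (x - (t - s) * x')).
  have := mulr_ge0 w0 (sqr_ge0 (y - (t - s) * y')).
  lra.
rewrite -phiE phiD in h.
have h2 : (t - s) ^+ 2 * E <= (t - s) ^+ 2 * e ^+ 2 by rewrite ler_wpM2l// sqr_ge0.
rewrite exprMn; lra.
Qed.

End dual_norm.

(** * Wick multiplication by a series of degree one *)
Section wick_degree_one.
Context {R : realType}.
Local Notation fseries := (@fseries R).
Implicit Types (f g : fseries) (p : nat) (al ga : mindex).

Definition unit_index (n : nat) : mindex := [fsfun [fsfun] with n |-> 1%N].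

Definition decr al (n : nat) : mindex := [fsfun al with n |-> (al n).-1].

Lemma unit_indexE n k : unit_index n k = (k == n).
Proof. by rewrite fsfun_withE fsfun0E; case: eqP. Qed.

Lemma unit_index_inj : injective unit_index.
Proof.
move=> m n /fsfunP /(_ m); rewrite !unit_indexE eqxx.
by case: eqP.
Qed.

Lemma decrE al n k : decr al n k = (al k - (k == n))%N.
Proof. by rewrite fsfun_withE; case: eqP => [->|]; rewrite ?subn1 ?subn0. Qed.

Lemma add_unit_index al ga n :
  (forall k, (al k + unit_index n k)%N = ga k) <->
  al = decr ga n /\ n \in finsupp ga.
Proof.
split=> [h|[-> ngap] k]; last first.
  rewrite decrE unit_indexE subnK//; case: eqP => // ->.
  by move: ngap; rewrite mem_finsupp lt0n.
have gan : ga n = (al n).+1 by rewrite -h unit_indexE eqxx addn1.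
split; last by rewrite mem_finsupp gan.
by apply/fsfunP => k; rewrite decrE -h unit_indexE addnK.
Qed.

(** Series in the span of the [Z_n], the multi-indices [unit_index n] being those
    of total degree one. Both processes take their values there. *)
Definition degree_one g := forall al, g al != 0 -> exists n, al = unit_index n.

Lemma wick_degree_one f g ga : degree_one g ->
  wick f g ga = \sum_(n <- finsupp ga) f (decr ga n) * g (unit_index n).
Proof.
move=> g1; rewrite /wick.
pose h (n : nat) : mindex * mindex := (decr ga n, unit_index n).
have h_inj : injective h by move=> m n [_ /unit_index_inj].
rewrite -(@fsbig_widen _ _ _ _ (h @` [set` finsupp ga])).
- rewrite fsbig_image; last by move=> m n _ _; exact: h_inj.
  by rewrite -fsbig_seq ?fset_uniq.
- move=> _ [n /= nga <-] k /=.
  by move: k; exact: (add_unit_index _ _ _).2.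
- move=> [al be] /= [abE nh]; apply: contrapT => /eqP.
  rewrite mulf_eq0 negb_or => /andP[_ /g1[n bE]]; subst be.
  have [alE nga] := (add_unit_index _ _ _).1 abE.
  by apply: nh; exists n; rewrite // /h alE.
Qed.

Lemma fseriesDE f1 f2 al : (f1 + f2) al = f1 al + f2 al.
Proof. by []. Qed.

Lemma fseriesBE f1 f2 al : (f1 - f2) al = f1 al - f2 al.
Proof. by []. Qed.

Lemma degree_oneB g1 g2 : degree_one g1 -> degree_one g2 -> degree_one (g1 - g2).
Proof.
move=> d1 d2 al; rewrite fseriesBE.
have [/d1 //|/negbNE /eqP ->] := boolP (g1 al != 0).
have [/d2 //|/negbNE /eqP ->] := boolP (g2 al != 0).
by rewrite subr0 eqxx.
Qed.

Lemma degree_oneZ (c : R[i]) g : degree_one g -> degree_one (fun al => c * g al).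
Proof. by move=> d al h; apply: d; apply: contraNneq h => ->; rewrite mulr0. Qed.

Lemma wickBl f1 f2 g : degree_one g -> wick (f1 - f2) g = wick f1 g - wick f2 g.
Proof.
move=> g1; apply/funext => ga; rewrite fseriesBE !wick_degree_one// -sumrB.
by apply: eq_bigr => n _; rewrite fseriesBE mulrBl.
Qed.

Lemma wickBr f g1 g2 : degree_one g1 -> degree_one g2 ->
  wick f (g1 - g2) = wick f g1 - wick f g2.
Proof.
move=> d1 d2; have d12 := degree_oneB d1 d2.
apply/funext => ga; rewrite fseriesBE !wick_degree_one// -sumrB.
by apply: eq_bigr => n _; rewrite fseriesBE mulrBr.
Qed.

Lemma wickZr f g (c : R[i]) : degree_one g ->
  wick f (fun al => c * g al) = (fun al => c * wick f g al).
Proof.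
move=> d; have dc := degree_oneZ (c := c) d.
apply/funext => ga; rewrite !wick_degree_one// mulr_sumr.
by apply: eq_bigr => n _; rewrite mulrCA.
Qed.

Lemma evens_powE al (S : {fset nat}) : (finsupp al `<=` S)%fset ->
  evens_pow al = (\prod_(k <- S) (2 * k.+1) ^ al k)%N.
Proof.
move=> alS; rewrite /evens_pow; apply: big_fset_incl => // k _.
by rewrite memNfinsupp => /eqP ->.
Qed.

Lemma weight_decr p ga n : n \in finsupp ga ->
  weight p ga = weight p (decr ga n) * (((2 * n.+1)%N)%:R ^- p : R).
Proof.
move=> nga.
rewrite /weight -invfM -exprMn -natrM; congr (_%:R ^- _).
have sub : (finsupp (decr ga n) `<=` finsupp ga)%fset.
  apply/fsubsetP => k; rewrite !mem_finsupp decrE.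
  by apply: contraNN => /eqP ->.
rewrite (evens_powE (fsubset_refl _)) (evens_powE sub).
rewrite (big_fsetD1 n)//= [in RHS](big_fsetD1 n)//= decrE eqxx subn1.
rewrite mulnAC -expnSr prednK; last by move: nga; rewrite mem_finsupp lt0n.
congr (_ * _)%N; apply: eq_big_seq => k; rewrite !inE => /andP[kn _].
by rewrite decrE (negbTE kn) subn0.
Qed.

Lemma decr_inj n : {in [pred ga | n \in finsupp ga] &, injective (decr^~ n)}.
Proof.
move=> al be; rewrite !inE !mem_finsupp => an bn /fsfunP E.
apply/fsfunP => k; have := E k; rewrite !decrE.
by case: eqP => [->|_]; rewrite ?subn0// !subn1; case: (al n) (be n) an bn => [|i] [|j] //= _ _ ->.
Qed.

(** For [p = 2] the terms are below those of the telescoping sum of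
    [1 / (n + 1) - 1 / (n + 2)]. *)
Lemma sum_evens_pow_le1 p K : (1 < p)%N ->
  \sum_(n < K) ((2 * n.+1)%N%:R ^- p : R) <= 1.
Proof.
move=> p1.
suff h : \sum_(n < K) ((2 * n.+1)%N%:R ^- p : R) <= 1 - K.+1%:R^-1.
  by apply: le_trans h _; rewrite lerBlDr lerDl invr_ge0.
elim: K => [|K IH]; first by rewrite big_ord0 invr1 subrr.
rewrite big_ord_recr /=.
have : (2 * K.+1)%N%:R ^- p <= K.+1%:R^-1 - K.+2%:R^-1 :> R.
  apply: (@le_trans _ _ ((2 * K.+1)%N%:R ^- 2)).
    rewrite lef_pV2 ?posrE ?exprn_gt0 ?ltr0n//.
    by rewrite ler_weXn2l// ler1n.
  rewrite -subr_ge0.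
  have k0 : 1 <= K.+1%:R :> R by rewrite ler1n.
  rewrite -[K.+2%:R]natr1 natrM; move: (K.+1%:R : R) k0 => x x1.
  have -> : x^-1 - (x + 1)^-1 - (2 * x) ^- 2
      = (3 * x - 1) / (4 * x ^+ 2 * (x + 1)).
    by field; rewrite !gt_eqF//; lra.
  rewrite divr_ge0//; first lra.
  by rewrite !mulr_ge0// ?sqr_ge0//; lra.
by move=> h; have := lerD IH h; rewrite addrA subrK.
Qed.

(** The dual norms are submultiplicative against degree-one series: by
    Cauchy-Schwarz a coefficient of the product is at most
    [|g|_0 * (sum_n |f_(ga - e_n)|^2)^(1/2)], and the lowering [ga -> ga - e_n]
    costs a factor [(2 n + 2)^(-p)], whose sum over [n] is at most [1]. *)
Lemma dnorm_le_wick p f g M N : (1 < p)%N -> degree_one g ->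
  dnorm_le p f M -> dnorm_le 0 g N -> dnorm_le p (wick f g) (M * N).
Proof.
move=> p1 g1 hf hg F.
have coef ga : normc (wick f g ga) ^+ 2 * weight p ga <=
    N ^+ 2 * \sum_(n <- finsupp ga) (2 * n.+1)%N%:R ^- p *
      (normc (f (decr ga n)) ^+ 2 * weight p (decr ga n)).
  rewrite wick_degree_one//.
  apply: (@le_trans _ _ (N ^+ 2 * (\sum_(n <- finsupp ga) normc (f (decr ga n)) ^+ 2)
     * weight p ga)).
    rewrite ler_wpM2r ?weight_ge0//.
    apply: (@le_trans _ _ ((\sum_(n <- finsupp ga)
        normc (g (unit_index n)) * normc (f (decr ga n))) ^+ 2)).
      rewrite ler_pXn2r// ?nnegrE ?normc_ge0//.
        apply: le_trans (ler_normc_sum _ _) _; apply: ler_sum => n _.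
        by rewrite normcM mulrC.
      by apply: sumr_ge0 => n _; rewrite mulr_ge0 ?normc_ge0.
    apply: le_trans (cauchy_schwarz_sum _ _ _) _.
    rewrite ler_wpM2r//; first by apply: sumr_ge0 => n _; exact: sqr_ge0.
    have := hg [fset unit_index n | n in finsupp ga]%fset.
    rewrite big_imfset /=; last by move=> m n _ _; exact: unit_index_inj.
    by under eq_bigr do rewrite /weight expr0 invr1 mulr1.
  rewrite -mulrA ler_wpM2l ?sqr_ge0// mulr_suml.
  rewrite big_seq_cond [leRHS]big_seq_cond; apply: ler_sum => n; rewrite andbT => nga.
  by rewrite (weight_decr _ nga) mulrA mulrC.
apply: le_trans (ler_sum _ (fun ga _ => coef ga)) _.
rewrite -mulr_sumr exprMn mulrC ler_wpM2r ?sqr_ge0//.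
pose K := (\max_(ga <- F) \max_(n <- finsupp ga) n.+1)%N.
pose T n ga := normc (f (decr ga n)) ^+ 2 * weight p (decr ga n).
apply: (@le_trans _ _ (\sum_(n < K) (2 * n.+1)%N%:R ^- p * M ^+ 2)); last first.
  by rewrite -mulr_suml ler_piMl ?sqr_ge0// sum_evens_pow_le1.
(* exchange the sums: for fixed [n], lowering by [e_n] is injective on the [ga]
   concerned, so the inner sum is part of the norm of [f] *)
apply: (@le_trans _ _ (\sum_(ga <- F) \sum_(n < K | (n : nat) \in finsupp ga)
     (2 * n.+1)%N%:R ^- p * T n ga)).
  rewrite big_seq_cond [leRHS]big_seq_cond; apply: ler_sum => ga; rewrite andbT => gaF.
  rewrite -(big_mkord (fun n => n \in finsupp ga) (fun n => (2 * n.+1)%N%:R ^- p * T n ga)).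
  rewrite -[leRHS]big_filter le_eqVlt; apply/orP; left; apply/eqP.
  apply: perm_big; apply: uniq_perm; rewrite ?fset_uniq ?filter_uniq ?iota_uniq//.
  move=> n; rewrite mem_filter mem_index_iota /=.
  case: (boolP (n \in finsupp ga)) => //= nga; apply/esym.
  apply: (@leq_trans (\max_(n <- finsupp ga) n.+1)).
    exact: (@leq_bigmax_seq _ _ _ (fun n => n.+1)).
  exact: (@leq_bigmax_seq _ _ _ (fun ga : mindex => \max_(n <- finsupp ga) n.+1)%N).
rewrite (exchange_big_dep xpredT) //=; apply: ler_sum => n _.
rewrite -mulr_sumr ler_wpM2l ?invr_ge0 ?exprn_ge0//.
pose F' := [fset ga in F | (n : nat) \in finsupp ga]%fset.
have := hf [fset decr ga n | ga in F']%fset.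
rewrite big_imfset /=; last first.
  by move=> al be; rewrite !inE => /andP[_ an] /andP[_ bn]; exact: decr_inj.
by move=> h; rewrite big_fset_condE; exact: h.
Qed.

End wick_degree_one.

(** * Strongly continuous paths in the inductive limit *)
Section strong_topology.
Context {R : realType}.
Local Notation fseries := (@fseries R).
Implicit Types (f phi : fseries) (p k : nat) (al : mindex) (F : {fset mindex}).

(** Uniform convergence on bounded sets of test elements is the only way in which
    the strong topology enters. *)
Lemma strong_within_continuous (a b : R) (Y : R -> fseries) (B : set fseries)
    (t e : R) :
  {within `[a, b], continuous (fun t => strong_dual (Y t))} ->
  S1_bounded B -> t \in `[a, b] -> 0 < e ->
  exists2 delta, 0 < delta & forall s, s \in `[a, b] -> `|s - t| < delta ->
    forall phi, B phi -> normc (duality (Y s) phi - duality (Y t) phi) < e.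
Proof.
move=> /subspace_continuousP cY bB tab e0.
have /fam_cvgP /(_ B bB) h := cY t tab.
pose E := [set xy : R[i]^o * R[i]^o | ball xy.1 (e%:C)%C xy.2].
have := h [set g | forall phi, B phi -> E (strong_dual (Y t) phi, g phi)].
have NE : nbhs (strong_dual (Y t) : {uniform` B -> R[i]^o})
  [set g | forall phi, B phi -> E (strong_dual (Y t) phi, g phi)].
  apply/uniform_nbhs; exists E; split => //.
  rewrite -entourage_ballE; exists (e%:C)%C => //=.
  by rewrite /= ltcR.
move=> /(_ NE); rewrite /= nbhs_simpl /= /within /=.
move=> /nbhs_ballP [d /= d0 hd].
exists d => // s sab st phi Bphi.
have := hd s; rewrite -ball_normE /= distrC => /(_ st sab phi Bphi).
by rewrite /E /= -ball_normE /= distrC normcE ltcR.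
Qed.

Lemma Rsum_finite (F : {fset mindex}) (x : mindex -> R) :
  (forall al, al \notin F -> x al = 0) -> Rsum x = \sum_(al <- F) x al.
Proof.
move=> x0; rewrite /Rsum.
have H (y : mindex -> R) : (forall al, 0 <= y al) ->
    (forall al, al \notin F -> y al = 0) ->
    fine (\esum_(al in [set: mindex]) (y al)%:E) = \sum_(al <- F) y al.
  move=> yge0 y0.
  have -> : \esum_(al in [set: mindex]) (y al)%:E = \esum_(al in [set` F]) (y al)%:E.
    rewrite [RHS]esum_mkcond; apply: eq_esum => al _.
    by case: ifPn => //; rewrite notin_setE /= => /negP /y0 ->.
  rewrite esum_fset; [|exact: finite_fset|by move=> al _; rewrite lee_fin].
  by rewrite -fsbig_seq ?fset_uniq// sumEFin.
rewrite !H.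
- rewrite -sumrB; apply: eq_bigr => al _.
  have [h|/ltW h] := leP 0 (x al).
    by rewrite max_r ?subr0// oppr_le0.
  by rewrite max_l ?oppr_ge0// sub0r opprK.
- by move=> al; rewrite le_max lexx orbT.
- by move=> al /x0 ->; rewrite oppr0 maxxx.
- by move=> al; rewrite le_max lexx orbT.
- by move=> al /x0 ->; rewrite maxxx.
Qed.

Lemma duality_finite (F : {fset mindex}) f phi :
  (forall al, al \notin F -> phi al = 0) ->
  duality f phi = \sum_(al <- F) (mfact al)%:R * f al * phi al.
Proof.
move=> phi0; rewrite /duality /Csum.
rewrite !(@Rsum_finite F).
- by rewrite [RHS]complex_eta !raddf_sum.
- by move=> al /phi0 ->; rewrite mulr0.
- by move=> al /phi0 ->; rewrite mulr0.
Qed.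

Lemma test_normsq_finite k F phi :
  (forall al, al \notin F -> phi al = 0) ->
  test_normsq k phi = (\sum_(al <- F) (mfact al)%:R ^+ 2 * normc (phi al) ^+ 2
                        * (evens_pow al)%:R ^+ k)%:E.
Proof.
move=> phi0; rewrite /test_normsq.
rewrite -sumEFin fsbig_seq ?fset_uniq// -esum_fset; last 2 first.
- exact: finite_fset.
- by move=> al _; rewrite lee_fin -exprMn mulr_ge0 ?sqr_ge0// exprn_ge0.
rewrite [RHS]esum_mkcond; apply: eq_esum => al _.
case: ifPn => //; rewrite notin_setE /= => /negP /phi0 ->.
by rewrite normc0 expr0n mulr0 mul0r.
Qed.

Lemma normc_duality_le k F f phi M :
  (forall al, al \notin F -> phi al = 0) -> 0 <= M -> dnorm_le k f M ->
  (test_normsq k phi <= 1%:E)%E -> normc (duality f phi) <= M.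
Proof.
move=> phi0 M0 hf; rewrite (test_normsq_finite _ phi0) lee_fin => hphi.
rewrite (duality_finite _ phi0).
pose s al : R := Num.sqrt (weight k al).
have s_gt0 al : 0 < s al by rewrite sqrtr_gt0 weight_gt0.
apply: (@le_trans _ _ (\sum_(al <- F) (normc (f al) * s al) *
   ((mfact al)%:R * normc (phi al) * (s al)^-1))).
  apply: le_trans (ler_normc_sum _ _) _; apply: ler_sum => al _.
  rewrite !normcM -(rmorph_nat (real_complex R)) normc_real normr_nat.
  rewrite [leRHS](_ : _ = (mfact al)%:R * normc (f al) * normc (phi al))//.
  by field; rewrite gt_eqF.
rewrite -(@ler_pXn2r _ 2)// ?nnegrE//; last first.
  by apply: sumr_ge0 => al _; rewrite !mulr_ge0 ?normc_ge0 ?invr_ge0 ?(ltW (s_gt0 _)).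
apply: le_trans (cauchy_schwarz_sum _ _ _) _.
rewrite -[leRHS]mulr1 ler_pM//.
- by apply: sumr_ge0 => al _; exact: sqr_ge0.
- by apply: sumr_ge0 => al _; exact: sqr_ge0.
- apply: le_trans (hf F); apply: ler_sum => al _.
  by rewrite exprMn sqr_sqrtr ?weight_ge0.
- apply: le_trans hphi; apply: ler_sum => al _.
  rewrite !exprMn exprVn sqr_sqrtr ?weight_ge0//.
  by rewrite /weight invrK.
Qed.

(** The test element is [f] itself, conjugated, weighted and cut off to finitely
    many coordinates: the equality case of Cauchy-Schwarz between the dual norm
    and the test norm of the same index. *)
Lemma large_dnorm_witness k f (N : R) : 0 <= N -> ~ dnorm_le k f N ->
  exists F phi, [/\ forall al, al \notin F -> phi al = 0,
    (test_normsq k phi <= 1%:E)%E & normc (duality f phi) = N].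
Proof.
move=> N0 /existsNP [F /negP]; rewrite -ltNge.
set S := \sum_(al <- F) _ => NS.
have S0 : 0 < S by apply: le_lt_trans NS; exact: sqr_ge0.
have [c cS] : exists c, c * S = N by exists (N / S); rewrite divfK ?gt_eqF.
exists F, (fun al => if al \in F then
   (conjc (f al) * (c * weight k al / (mfact al)%:R)%:C)%C else 0).
have phi0 al : al \notin F -> (if al \in F then
   (conjc (f al) * (c * weight k al / (mfact al)%:R)%:C)%C else 0) = 0.
  by move/negbTE ->.
have mf0 al : (mfact al)%:R != 0 :> R.
  by rewrite pnatr_eq0 -lt0n /mfact prodn_gt0// => i; exact: fact_gt0.
(* the pairing with [f] is [c S = N], the squared norm is [c^2 S = N^2 / S < 1] *)
split => //.
- rewrite (test_normsq_finite _ phi0) lee_fin.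
  have -> : \sum_(al <- F) (mfact al)%:R ^+ 2 * normc (if al \in F then
   (conjc (f al) * (c * weight k al / (mfact al)%:R)%:C)%C else 0) ^+ 2 *
     (evens_pow al)%:R ^+ k = c ^+ 2 * S.
    rewrite /S mulr_sumr; apply: eq_big_seq => al ->.
    have -> : (evens_pow al)%:R ^+ k = (weight k al)^-1 :> R by rewrite /weight invrK.
    rewrite normcM normc_real exprMn real_normK ?num_real//.
    have -> : normc (conjc (f al)) = normc (f al) by case: (f al) => x y /=; rewrite sqrrN.
    have := mf0 al; have := @weight_gt0 R k al.
    move: (weight k al) => w w0 m0.
    by field; rewrite m0 gt_eqF.
  rewrite -(ler_pM2r S0) mul1r -mulrA -expr2 -exprMn cS; exact: ltW.
- rewrite (duality_finite _ phi0).
  have -> : \sum_(al <- F) (mfact al)%:R * f al * (if al \in F then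
     (conjc (f al) * (c * weight k al / (mfact al)%:R)%:C)%C else 0) =
     ((c * S)%:C)%C.
    rewrite mulr_sumr rmorph_sum /=; apply: eq_big_seq => al ->.
    have -> : (mfact al)%:R = ((mfact al)%:R%:C)%C :> R[i] by rewrite rmorph_nat.
    rewrite normc_sq; have := mf0 al.
    case: (f al) => x y m0 /=; apply/eqP; rewrite eq_complex /=; apply/andP; split; apply/eqP.
      by field.
    by field.
  by rewrite cS normc_real ger0_norm.
Qed.

Lemma test_normsq_mono j k phi : (j <= k)%N ->
  (test_normsq j phi <= test_normsq k phi)%E.
Proof.
move=> jk; apply: le_esum => al _; rewrite lee_fin.
by rewrite ler_wpM2l -?exprMn ?sqr_ge0// ler_weXn2l// evens_pow_ge1.
Qed.

(** For fixed [j], the members of index at least [j] have [j]-norm at most one,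
    because the test norms increase with the index; finitely many are left. *)
Lemma unit_balls_bounded (F : nat -> {fset mindex}) (phi : nat -> fseries) :
  (forall k al, al \notin F k -> phi k al = 0) ->
  (forall k, (test_normsq k (phi k) <= 1%:E)%E) ->
  S1_bounded (range phi).
Proof.
move=> phi0 phi1.
have fin j k : test_normsq j (phi k) \is a fin_num by rewrite (test_normsq_finite _ (phi0 k)).
split=> [_ [k _ <-] j _ /=|j j0].
  by rewrite /in_H /= -ge0_fin_numE ?fin// (test_normsq_finite _ (phi0 k)) lee_fin;
    apply: sumr_ge0 => al _; rewrite -exprMn mulr_ge0 ?sqr_ge0 ?exprn_ge0.
exists (1 + \sum_(k < j) `|fine (test_normsq j (phi k))|) => _ [k _ <-].
rewrite -(fineK (fin j k)) lee_fin.
have [jk|kj] := leqP j k.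
  apply: (@le_trans _ _ 1); last by rewrite lerDl sumr_ge0.
  rewrite -lee_fin fineK//.
  by apply: le_trans (phi1 k); exact: test_normsq_mono.
rewrite (bigD1 (Ordinal kj)) //= addrCA; apply: le_trans (ler_norm _) _.
by rewrite lerDl addr_ge0// sumr_ge0.
Qed.

Lemma bounded_on_unit_balls (F : nat -> {fset mindex}) (phi : nat -> fseries) f :
  (forall k al, al \notin F k -> phi k al = 0) ->
  (forall k, (test_normsq k (phi k) <= 1%:E)%E) ->
  Sm1 f -> exists C, forall k, normc (duality f (phi k)) <= C.
Proof.
move=> phi0 phi1 [j /= _ /in_Hdual_dnorm_le [M M0 hM]].
exists (M + \sum_(k < j) normc (duality f (phi k))) => k.
have [jk|kj] := leqP j k.
  apply: (@le_trans _ _ M); last first.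
    by rewrite lerDl sumr_ge0// => i _; exact: normc_ge0.
  apply: (normc_duality_le (phi0 k) M0 hM).
  by apply: le_trans (phi1 k); exact: test_normsq_mono.
rewrite (bigD1 (Ordinal kj)) //= addrCA lerDl addr_ge0//.
by rewrite sumr_ge0// => i _; exact: normc_ge0.
Qed.

(** Strong continuity on a compact interval keeps the values in a bounded part
    of a single [H_k']: otherwise, for every [k], some value has a test element
    of [k]-norm at most one on which it has modulus [k]; these test elements form a
    bounded set of the test space, on which a continuous path is bounded. *)
Lemma strong_continuous_bounded (a b : R) (Y : R -> fseries) :
  (forall t, t \in `[a, b] -> Sm1 (Y t)) ->
  {within `[a, b], continuous (fun t => strong_dual (Y t))} ->
  exists k M, 0 <= M /\ forall t, t \in `[a, b] -> dnorm_le k (Y t) M.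
Proof.
move=> Y1 cY; apply: contrapT => noM.
have wit (k : nat) : exists tFphi : R * {fset mindex} * fseries,
    [/\ tFphi.1.1 \in `[a, b],
        forall al, al \notin tFphi.1.2 -> tFphi.2 al = 0,
        (test_normsq k tFphi.2 <= 1%:E)%E &
        normc (duality (Y tFphi.1.1) tFphi.2) = k%:R].
  have /existsNP [t /not_implyP [tab ht]] :
      ~ (forall t, t \in `[a, b] -> dnorm_le k (Y t) k%:R).
    by move=> h; apply: noM; exists k, k%:R.
  have [//|F [phi [phi0 phi1 phik]]] := large_dnorm_witness _ ht.
  by exists (t, F, phi).
have {wit} [w hw] := choice wit.
pose phi k := (w k).2.
have phi0 k al : al \notin (w k).1.2 -> phi k al = 0 by have [_ h _ _] := hw k; exact: h.
have phi1 k : (test_normsq k (phi k) <= 1%:E)%E by have [] := hw k.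
have bB := unit_balls_bounded phi0 phi1.
have /compact_near_coveringP/near_covering_withinP cpt := @segment_compact R a b.
have := cpt R (pinfty_nbhs R)
  (fun C s => forall k, normc (duality (Y s) (phi k)) <= C) _.
have hloc (t : R) : `[a, b]%classic t -> \forall s \near t & C \near +oo,
    `[a, b]%classic s -> forall k, normc (duality (Y s) (phi k)) <= C.
  move=> tab.
  have [C hC] := bounded_on_unit_balls phi0 phi1 (Y1 _ tab).
  have [d d0 hd] := strong_within_continuous cY bB tab ltr01.
  exists (ball t d, [set C' | C + 1 <= C']).
    split; first exact: nbhsx_ballx.
    by exists (C + 1); split; rewrite ?num_real// => x /ltW.
  move=> [s C'] [/= st CC'] sab k.
  suff : normc (duality (Y s) (phi k)) <= C' by [].
  have st' : `|s - t| < d by move: st; rewrite -ball_normE /= distrC.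
  have := hd s sab st' (phi k) (ex_intro2 _ _ k I erefl) => lt1.
  apply: le_trans CC'.
  rewrite -[duality (Y s) _](subrK (duality (Y t) (phi k))).
  apply: le_trans (ler_normcD _ _) _.
  by rewrite addrC lerD// ltW.
move=> /(_ _ hloc) [C0 [_ hC0]].
pose C := Num.max (C0 + 1) 0.
have /hC0 hC : C0 < C by rewrite lt_max ltrDl ltr01.
have [tab _ _ E] := hw (Num.truncn C).+1.
have := hC _ tab (Num.truncn C).+1.
by rewrite E leNgt truncnS_gt.
Qed.

(** If [evens_pow al <= N] then the support of [al] lies below [N] and so do its
    entries, whence finitely many [al]. *)
Lemma evens_pow_bounded_finite (N : nat) :
  exists F : {fset mindex}, forall al, al \notin F -> (N < evens_pow al)%N.
Proof.
pose mk (g : {ffun 'I_N -> 'I_N.+1}) : mindex :=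
  [fsfun k in [fset k | k in iota 0 N]%fset =>
     (if insub k is Some i then g i : nat else 0%N) | 0%N].
have fin : finite_set [set al : mindex | (evens_pow al <= N)%N].
  apply: (@sub_finite_set _ _ (mk @` setT)).
    move=> al /= alN.
    have bnd k : ((2 * k.+1) ^ al k <= N)%N.
      apply: leq_trans alN; rewrite /evens_pow.
      have [kal|] := boolP (k \in finsupp al); last first.
        by rewrite memNfinsupp => /eqP ->; rewrite expn0 -/(evens_pow al) evens_pow_gt0.
      rewrite (big_fsetD1 k)//= leq_pmulr// prodn_gt0// => i.
      by rewrite expn_gt0.
    exists [ffun i : 'I_N => inord (al i)] => //.
    apply/fsfunP => k; rewrite fsfunE !inE /= mem_iota add0n /=.
    have alk : (al k <= N)%N.
      by apply: leq_trans (bnd k); apply/ltnW/ltn_expl; rewrite mulnS.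
    case: ifPn => [kN|].
      by rewrite insubT ffunE inordK.
    rewrite -leqNgt => Nk; apply/esym/eqP; rewrite -leqn0 leqNgt; apply/negP => al0.
    have := leq_trans (leq_pexp2l (isT : 0 < 2 * k.+1)%N al0) (bnd k).
    rewrite expn1 leqNgt => /negP; apply.
    by apply: leq_ltn_trans Nk _; rewrite leq_pmull.
  exact: finite_image.
exists (fset_set [set al : mindex | (evens_pow al <= N)%N]) => al.
by rewrite in_fset_set// notin_setE /= ltnNge => /negP.
Qed.

Lemma coordinate_tests_bounded F :
  S1_bounded [set phi : fseries | exists2 al, al \in F &
     phi = fun be => (be == al)%:R].
Proof.
have H j al : test_normsq j (fun be => (be == al)%:R : R[i]) =
    ((mfact al)%:R ^+ 2 * (evens_pow al)%:R ^+ j)%:E.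
  rewrite (@test_normsq_finite _ [fset al]%fset); last first.
    by move=> be; rewrite inE => /negbTE ->.
  by rewrite big_seq_fset1 eqxx normc1 expr1n mulr1.
split=> [_ [al _ ->] j _|j _].
  by rewrite /in_H /= H ltry.
exists (\sum_(al <- F) (mfact al)%:R ^+ 2 * (evens_pow al)%:R ^+ j) => _ [al alF ->].
rewrite H lee_fin (big_fsetD1 al)//= lerDl.
by apply: sumr_ge0 => be _; rewrite mulr_ge0 ?sqr_ge0 ?exprn_ge0.
Qed.

(** On a bounded part of [H_k'], the [k.+1]-norm is controlled by finitely many
    coefficients, since the extra weight [1 / (2N)^al] tends to [0]. *)
Lemma strong_continuous_dnorm (a b : R) (Y : R -> fseries) k M t e :
  {within `[a, b], continuous (fun t => strong_dual (Y t))} ->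
  0 <= M -> (forall t, t \in `[a, b] -> dnorm_le k (Y t) M) ->
  t \in `[a, b] -> 0 < e ->
  exists2 delta, 0 < delta & forall s, s \in `[a, b] -> `|s - t| < delta ->
    dnorm_le k.+1 (Y s - Y t) e.
Proof.
move=> cY M0 hM tab e0.
(* the coefficients in [F] contribute at most [e^2 / 2] because each of them moves
   by at most [eta]; the others do so because of the extra factor [q], against the
   bound [2 M] on the [k]-norm of the difference *)
pose q := e ^+ 2 / 2 / (2 * (M + 1)) ^+ 2.
have q0 : 0 < q.
  by rewrite !divr_gt0 ?exprn_gt0// mulr_gt0// ltr_wpDl.
have [F hF] := evens_pow_bounded_finite (Num.truncn q^-1).
pose c := (#|` F|)%:R : R.
pose eta := e / (2 * (c + 1)).
have c0 : 0 <= c by rewrite ler0n.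
have eta0 : 0 < eta by rewrite divr_gt0// mulr_gt0// ltr_wpDl.
have [d d0 hd] := strong_within_continuous cY (coordinate_tests_bounded F) tab eta0.
exists d => // s sab st A.
have D := dnorm_leB M0 M0 (hM s sab) (hM t tab).
pose f := Y s - Y t.
have term al : normc (f al) ^+ 2 * weight k.+1 al <=
    (if al \in F then eta ^+ 2 else 0) + q * (normc (f al) ^+ 2 * weight k al).
  have w1 : weight k.+1 al = weight k al * (evens_pow al)%:R^-1 :> R.
    by rewrite /weight -invfM -exprSr.
  have [alF|/hF alF] := boolP (al \in F).
    have f_eta : normc (f al) ^+ 2 <= eta ^+ 2.
      rewrite ler_pXn2r// ?nnegrE ?normc_ge0 ?ltW//.
      have := hd s sab st _ (ex_intro2 _ _ al alF erefl).
      have dE (g : fseries) : duality g (fun be => (be == al)%:R : R[i]) = (mfact al)%:R * g al.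
        rewrite (@duality_finite [fset al]%fset); last first.
          by move=> be; rewrite inE => /negbTE ->.
        by rewrite big_seq_fset1 eqxx mulr1.
      rewrite !dE -mulrBr normcM; apply: le_lt_trans.
      rewrite -[leLHS]mul1r ler_wpM2r ?normc_ge0//.
      rewrite -(rmorph_nat (real_complex R)) normc_real normr_nat ler1n.
      by rewrite /mfact prodn_gt0// => i; exact: fact_gt0.
    rewrite -[leLHS]addr0 lerD//; last first.
      by rewrite mulr_ge0 ?(ltW q0) ?dnorm_term_ge0.
    rewrite -[leRHS]mulr1 ler_pM ?sqr_ge0 ?weight_ge0//.
    by rewrite /weight invf_le1 ?exprn_ege1 ?evens_pow_ge1// exprn_gt0// ltr0n evens_pow_gt0.
  rewrite add0r w1 mulrA [leRHS]mulrC ler_wpM2l ?dnorm_term_ge0//.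
  rewrite -[q]invrK lef_pV2 ?posrE ?invr_gt0 ?ltr0n ?evens_pow_gt0//.
  apply: ltW; apply: lt_le_trans (truncnS_gt _) _.
  by rewrite ler_nat.
apply: le_trans (ler_sum _ (fun al _ => term al)) _.
rewrite big_split /= -mulr_sumr.
have h1 : \sum_(al <- A) (if al \in F then eta ^+ 2 else 0) <= c * eta ^+ 2.
  rewrite -big_mkcond /= big_fset_condE /= big_const_seq count_predT iter_addr_0.
  rewrite -mulr_natl ler_wpM2r ?sqr_ge0// ler_nat.
  by apply: fsubset_leq_card; apply/fsubsetP => al; rewrite !inE => /andP[].
have h2 : q * \sum_(al <- A) normc (f al) ^+ 2 * weight k al <= q * (M + M) ^+ 2.
  by rewrite ler_wpM2l ?(ltW q0)// D.
apply: le_trans (lerD h1 h2) _.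
have h3 : c * eta ^+ 2 <= e ^+ 2 / 2.
  have c1 : 0 < c + 1 by rewrite ltr_wpDl.
  rewrite /eta expr_div_n mulrA ler_pdivrMr ?exprn_gt0 ?mulr_gt0//.
  rewrite mulrAC ler_pdivlMr// -mulrA mulrC -mulrA ler_wpM2l ?sqr_ge0//.
  by nra.
have h4 : q * (M + M) ^+ 2 <= e ^+ 2 / 2.
  have M1 : 0 < M + 1 by rewrite ltr_wpDl.
  rewrite /q mulrAC ler_pdivrMr ?exprn_gt0 ?mulr_gt0//.
  rewrite ler_wpM2l ?divr_ge0 ?sqr_ge0//.
  by rewrite ler_pXn2r ?nnegrE ?mulr_ge0 ?addr_ge0//; lra.
by rewrite (splitr (e ^+ 2)) lerD.
Qed.

(** The Heine-Cantor argument, for the norm continuity just obtained. *)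
Lemma strong_continuous_uniform (a b : R) (Y : R -> fseries) k M e :
  {within `[a, b], continuous (fun t => strong_dual (Y t))} ->
  0 <= M -> (forall t, t \in `[a, b] -> dnorm_le k (Y t) M) -> 0 < e ->
  exists2 delta, 0 < delta & forall s t, s \in `[a, b] -> t \in `[a, b] ->
    `|s - t| < delta -> dnorm_le k.+1 (Y s - Y t) e.
Proof.
move=> cY M0 hM e0.
have /compact_near_coveringP/near_covering_withinP cpt := @segment_compact R a b.
have := cpt R (0:R)^'+ (fun delta s => forall t, t \in `[a, b] ->
    `|s - t| < delta -> dnorm_le k.+1 (Y s - Y t) e) _.
have hloc (x : R) : `[a, b]%classic x -> \forall s \near x & delta \near (0:R)^'+,
    `[a, b]%classic s -> forall t, t \in `[a, b] ->
    `|s - t| < delta -> dnorm_le k.+1 (Y s - Y t) e.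
  move=> xab.
  have e2 : 0 < e / 2 by rewrite divr_gt0.
  have [d d0 hd] := strong_continuous_dnorm cY M0 hM xab e2.
  have d2 : 0 < d / 2 by rewrite divr_gt0.
  exists (ball x (d / 2), [set delta | delta < d / 2]).
    split; first exact: nbhsx_ballx.
    exact: nbhs_right_lt.
  move=> [s delta] [/= sx deltad] sab t tab st.
  rewrite -ball_normE /= distrC in sx.
  suff : dnorm_le k.+1 ((Y s - Y x) - (Y t - Y x)) (e / 2 + e / 2).
    by rewrite opprB addrA subrK -splitr.
  apply: dnorm_leB; rewrite ?(ltW e2)//; apply: hd => //.
    by apply: lt_trans sx _; lra.
  have -> : t - x = (s - x) - (s - t) by ring.
  apply: le_lt_trans (ler_normB _ _) _.
  by rewrite (splitr d) ltrD// (lt_trans st).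
move=> /(_ _ hloc) h.
have [delta [delta0 hdelta]] : exists delta : R, 0 < delta /\
    forall s, s \in `[a, b] -> forall t, t \in `[a, b] ->
    `|s - t| < delta -> dnorm_le k.+1 (Y s - Y t) e.
  have h0 : \forall delta \near (0:R)^'+, 0 < delta by exact: nbhs_right_gt.
  have [delta [? ?]] := filter_ex (filterI h0 h).
  by exists delta.
by exists delta => // s t sab tab; exact: hdelta.
Qed.

End strong_topology.

(** * Complex integrals and Bessel's inequality *)
Section complex_integral.
Context {R : realType} d (T : measurableType d) (mu : {measure set T -> \bar R}).
Implicit Types (f g : T -> R) (F G : T -> R[i]).

Local Notation Rint f := (mu.-integrable [set: T] (EFin \o f)).

Lemma RintD f g : Rint f -> Rint g -> Rint (fun x => f x + g x).
Proof.
move=> hf hg; rewrite (_ : _ \o _ = (EFin \o f) \+ (EFin \o g))%E//.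
exact: integrableD.
Qed.

Lemma RintB f g : Rint f -> Rint g -> Rint (fun x => f x - g x).
Proof.
move=> hf hg; rewrite (_ : _ \o _ = (EFin \o f) \- (EFin \o g))%E//.
exact: integrableB.
Qed.

Lemma RintZ (c : R) f : Rint f -> Rint (fun x => c * f x).
Proof.
move=> hf; rewrite (_ : _ \o _ = (fun x => c%:E * (EFin \o f) x)%E)//.
exact: integrableZl.
Qed.

Definition Cintegrable F :=
  Rint (fun x => complex.Re (F x)) /\ Rint (fun x => complex.Im (F x)).

Local Notation CI := (Cintegral mu [set: T]).

Lemma CintegrableD F G : Cintegrable F -> Cintegrable G ->
  Cintegrable (fun x => F x + G x).
Proof.
by move=> [F1 F2] [G1 G2]; split; under eq_fun do rewrite raddfD /=; exact: RintD.
Qed.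

Lemma CintegralD F G : Cintegrable F -> Cintegrable G ->
  CI (fun x => F x + G x) = CI F + CI G.
Proof.
move=> [F1 F2] [G1 G2]; rewrite /Cintegral.
under eq_Rintegral do rewrite raddfD /=.
under [in X in (_ +i* X)%C]eq_Rintegral do rewrite raddfD /=.
by rewrite !RintegralD.
Qed.

Lemma Re_mul (z w : R[i]) : complex.Re (z * w) =
  complex.Re z * complex.Re w - complex.Im z * complex.Im w.
Proof. by case: z w => a b [c e]. Qed.

Lemma Im_mul (z w : R[i]) : complex.Im (z * w) =
  complex.Re z * complex.Im w + complex.Im z * complex.Re w.
Proof. by case: z w => a b [c e]. Qed.

Lemma CintegrableZ (c : R[i]) F : Cintegrable F -> Cintegrable (fun x => c * F x).
Proof.
move=> [F1 F2]; split.
  by under eq_fun do rewrite Re_mul; apply: RintB; exact: RintZ.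
by under eq_fun do rewrite Im_mul; apply: RintD; exact: RintZ.
Qed.

Lemma CintegralZ (c : R[i]) F : Cintegrable F ->
  CI (fun x => c * F x) = c * CI F.
Proof.
move=> [F1 F2]; rewrite /Cintegral.
under eq_Rintegral do rewrite Re_mul.
under [in X in (_ +i* X)%C]eq_Rintegral do rewrite Im_mul.
rewrite RintegralB ?RintegralD ?RintegralZl//; try exact: RintZ.
by case: c.
Qed.

Lemma Cintegrable0 : Cintegrable (fun=> 0).
Proof. by split; exact: integrable0. Qed.

Lemma Cintegral0 : CI (fun=> 0) = 0.
Proof. by rewrite /Cintegral /= /Rintegral integral0. Qed.

Lemma Cintegrable_sum (I : Type) (r : seq I) (F : I -> T -> R[i]) :
  (forall i, Cintegrable (F i)) -> Cintegrable (fun x => \sum_(i <- r) F i x).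
Proof.
move=> hF; elim: r => [|i r IH].
  by under eq_fun do rewrite big_nil; exact: Cintegrable0.
by under eq_fun do rewrite big_cons; exact: CintegrableD.
Qed.

Lemma Cintegral_sum (I : Type) (r : seq I) (F : I -> T -> R[i]) :
  (forall i, Cintegrable (F i)) ->
  CI (fun x => \sum_(i <- r) F i x) = \sum_(i <- r) CI (F i).
Proof.
move=> hF; elim: r => [|i r IH].
  by under eq_fun do rewrite big_nil; rewrite big_nil Cintegral0.
under eq_fun do rewrite big_cons.
by rewrite big_cons CintegralD ?IH//; exact: Cintegrable_sum.
Qed.

Lemma Re_mulJ (z w : R[i]) : 2 * complex.Re (z * (conjc w)) <= normc z ^+ 2 + normc w ^+ 2.
Proof.
rewrite !normc_sq; case: z w => a b [c e] /=.
by have := sqr_ge0 (a - c); have := sqr_ge0 (b - e); lra.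
Qed.

Lemma mulJE (z : R[i]) : z * conjc z = ((normc z ^+ 2)%:C)%C.
Proof.
rewrite normc_sq; case: z => a b /=; apply/eqP; rewrite eq_complex /=.
by apply/andP; split; apply/eqP; ring.
Qed.

(** Bessel's inequality: the partial sum [G] of the expansion of [F] satisfies
    [<F, G> = |G|^2], and [2 Re <F, G> <= |F|^2 + |G|^2]. *)
Lemma bessel (N : nat) (e : nat -> T -> R[i]) (F : T -> R[i]) :
  (forall m n, Cintegrable (fun x => e m x * conjc (e n x))) ->
  (forall m n, CI (fun x => e m x * conjc (e n x)) = (m == n)%:R) ->
  (forall n, Cintegrable (fun x => F x * conjc (e n x))) ->
  Rint (fun x => normc (F x) ^+ 2) ->
  \sum_(n < N) normc (CI (fun x => F x * conjc (e n x))) ^+ 2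
    <= Rintegral mu [set: T] (fun x => normc (F x) ^+ 2).
Proof.
move=> ie oe iF iF2.
pose c n := CI (fun x => F x * conjc (e n x)).
pose G x := \sum_(n < N) c n * e n x.
pose S := \sum_(n < N) normc (c n) ^+ 2.
have FG : (fun x => F x * conjc (G x)) =
    (fun x => \sum_(n < N) conjc (c n) * (F x * conjc (e n x))).
  apply/funext => x; rewrite /G rmorph_sum /= mulr_sumr; apply: eq_bigr => n _.
  by rewrite rmorphM /= mulrCA.
have GG : (fun x => G x * conjc (G x)) = (fun x => \sum_(m < N) \sum_(n < N)
     (c m * conjc (c n)) * (e m x * conjc (e n x))).
  apply/funext => x; rewrite /G rmorph_sum /= mulr_suml; apply: eq_bigr => m _.
  by rewrite mulr_sumr; apply: eq_bigr => n _; rewrite rmorphM /= mulrACA.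
have iFG : Cintegrable (fun x => F x * conjc (G x)).
  by rewrite FG; apply: Cintegrable_sum => n; exact: CintegrableZ.
have iGG : Cintegrable (fun x => G x * conjc (G x)).
  rewrite GG; apply: Cintegrable_sum => m; apply: Cintegrable_sum => n.
  exact: CintegrableZ.
have IFG : CI (fun x => F x * conjc (G x)) = (S%:C)%C.
  rewrite FG Cintegral_sum; last by move=> n; exact: CintegrableZ.
  rewrite /S rmorph_sum /=; apply: eq_bigr => n _.
  by rewrite CintegralZ// -/(c n) mulrC mulJE.
have IGG : CI (fun x => G x * conjc (G x)) = (S%:C)%C.
  rewrite GG Cintegral_sum; last first.
    by move=> m; apply: Cintegrable_sum => n; exact: CintegrableZ.
  rewrite /S rmorph_sum /=; apply: eq_bigr => m _.
  rewrite Cintegral_sum; last by move=> n; exact: CintegrableZ.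
  rewrite (bigD1 m)//= big1 ?addr0 => [|n nm]; rewrite CintegralZ// oe.
    by rewrite eqxx mulr1 mulJE.
  by rewrite eq_sym (_ : (_ == _) = false) ?mulr0//; exact: negbTE.
have h : 2 * S <= Rintegral mu [set: T] (fun x => normc (F x) ^+ 2) + S.
  have -> : S = Rintegral mu [set: T] (fun x => complex.Re (F x * conjc (G x))).
    by have := congr1 (@complex.Re R) IFG.
  rewrite [X in _ + X](_ : _ = Rintegral mu [set: T] (fun x => normc (G x) ^+ 2)); last first.
    have := congr1 (@complex.Re R) IFG; rewrite /= => ->.
    have := congr1 (@complex.Re R) IGG; rewrite /= => <-.
    by apply: eq_Rintegral => x _; rewrite mulJE.
  have iG2 : Rint (fun x => normc (G x) ^+ 2).
    by have [+ _] := iGG; under eq_fun do rewrite mulJE.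
  rewrite -RintegralZl//; last by have [] := iFG.
  rewrite -RintegralD//; apply: le_Rintegral => //.
  - by apply: RintZ; have [] := iFG.
  - exact: RintD.
  - by move=> x _; exact: Re_mulJ.
by rewrite -/S; lra.
Qed.

End complex_integral.

(** * Series of degree one *)
Section degree_one_series.
Context {R : realType}.
Local Notation fseries := (@fseries R).
Implicit Types (c : nat -> R[i]) (al : mindex).

(** The coefficients of [sum_n c_n Z_n]. Only [n] in the support of [al] can have
    [al = unit_index n], so a finite sum reads off the coefficient. *)
Definition linear_series c : fseries :=
  fun al => \sum_(n <- finsupp al) (if al == unit_index n then c n else 0).

Lemma mem_finsupp_unit n m : (m \in finsupp (unit_index n)) = (m == n).
Proof. by rewrite mem_finsupp unit_indexE; case: (m == n). Qed.

Lemma linear_series_unit c n : linear_series c (unit_index n) = c n.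
Proof.
rewrite /linear_series (big_fsetD1 n) ?mem_finsupp_unit//= eqxx.
rewrite big_seq big1 ?addr0// => m; rewrite !inE mem_finsupp_unit => /andP[/negbTE -> //].
Qed.

Lemma linear_series0 c al : (forall n, al != unit_index n) -> linear_series c al = 0.
Proof. by move=> h; rewrite /linear_series big1// => n _; rewrite (negbTE (h n)). Qed.

Lemma linear_series_degree_one c : degree_one (linear_series c).
Proof.
move=> al /eqP h; apply: contrapT => /forallNP no; apply: h.
by apply: linear_series0 => n; apply/eqP; exact: no.
Qed.

Lemma linear_seriesB c1 c2 :
  linear_series c1 - linear_series c2 = linear_series (fun n => c1 n - c2 n).
Proof.
apply/funext => al; rewrite /linear_series -[LHS]/(_ al - _ al) -sumrB.
by apply: eq_bigr => n _; case: ifP => _; rewrite ?subr0.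
Qed.

Lemma dnorm_le_linear_series c (M : R) :
  (forall N, \sum_(n < N) normc (c n) ^+ 2 <= M ^+ 2) ->
  dnorm_le 0 (linear_series c) M.
Proof.
move=> h F.
pose K := (\max_(al <- F) \max_(n <- finsupp al) n.+1)%N.
apply: le_trans (h K).
apply: (@le_trans _ _ (\sum_(al <- F) \sum_(n < K)
    (if al == unit_index n then normc (c n) ^+ 2 else 0))).
  rewrite big_seq_cond [leRHS]big_seq_cond; apply: ler_sum => al; rewrite andbT => alF.
  rewrite /weight expr0 invr1 mulr1.
  have [/linear_series_degree_one [n aln]|] := boolP (linear_series c al != 0); last first.
    move/negbNE/eqP => ->; rewrite normc0 expr0n /=.
    by apply: sumr_ge0 => n _; case: ifP => _; rewrite ?sqr_ge0.
  have nK : (n < K)%N.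
    apply: (@leq_trans (\max_(n <- finsupp al) n.+1)).
      apply: (@leq_bigmax_seq _ _ _ (fun n => n.+1)) => //.
      by rewrite aln mem_finsupp_unit.
    exact: (@leq_bigmax_seq _ _ _ (fun ga : mindex => \max_(n <- finsupp ga) n.+1)%N).
  rewrite (bigD1 (Ordinal nK))//= aln linear_series_unit eqxx lerDl.
  by apply: sumr_ge0 => m _; case: ifP => _; rewrite ?sqr_ge0.
rewrite exchange_big /=; apply: ler_sum => n _; rewrite -big_mkcond /=.
have [uF|uF] := boolP (unit_index n \in F).
  by rewrite -big_filter (filter_pred1_uniq (fset_uniq _) uF) big_seq1.
rewrite big_seq_cond big_pred0 ?sqr_ge0// => al.
by apply/negbTE/negP => /andP[alF /eqP E]; rewrite -E alF in uF.
Qed.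

End degree_one_series.

(** * Primitives of continuous functions *)
Section real_analysis.
Context {R : realType}.

Lemma probability_Rintegral_cst d (T : measurableType d) (P : probability T R) (c : R) :
  Rintegral P [set: T] (fun=> c) = c.
Proof.
rewrite Rintegral_cst//.
have -> : fine (P [set: T]) = 1 by rewrite probability_setT.
by rewrite mulr1.
Qed.

(** The integral from [c] is differentiable to the right of [c]; taking [c] below
    the interval of interest makes it differentiable at the endpoints as well. *)
Lemma exists_primitive (f : R -> R) (c : R) : continuous f ->
  exists G : R -> R, (forall x, c < x -> is_derive x (1 : R) G (f x)) /\
    forall s t, c < s -> s <= t ->
      Rintegral lebesgue_measure `[s, t] f = G t - G s.
Proof.
move=> cf.
have intf u v : lebesgue_measure.-integrable `[u, v] (EFin \o f).
  apply: continuous_compact_integrable; first exact: segment_compact.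
  exact: continuous_subspaceT.
exists (fun y => Rintegral lebesgue_measure `[c, y] f); split=> [x cx|s t cs st].
  have xx1 : x < x + 1 by rewrite ltrDl.
  have [dG GE] := continuous_FTC1_closed xx1 (intf c (x + 1)) cx (cf x).
  by apply: DeriveDef => //; rewrite -derive1E.
rewrite (@Rintegral_itvB _ f (BLeft c) (BRight t) s) ?bnd_simp ?(ltW cs)//.
by rewrite Rintegral_itv_obnd_cbnd//; apply: integrableS (intf s t) => //; exact: subset_itv_oc_cc.
Qed.

Lemma continuous_lipschitz (f : R -> R) (K : R) :
  (forall s t, `|f s - f t| <= K * `|s - t|) -> continuous f.
Proof.
move=> fK x; apply/cvgrPdist_le => e e0; near=> y.
apply: le_trans (fK _ _) _.
have K0 : 0 < `|K| + 1 by rewrite ltr_wpDl.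
apply: (@le_trans _ _ ((`|K| + 1) * `|x - y|)).
  by rewrite ler_wpM2r// ler_wpDr// ler_norm.
rewrite -ler_pdivlMl// mulrC; near: y.
apply: (@cvgr_dist_le _ _ _ _ (nbhs_filter x) id x) => //.
by rewrite divr_gt0.
Unshelve. all: by end_near. Qed.

Lemma clamp_lipschitz (a b x y : R) :
  `|Num.max a (Num.min x b) - Num.max a (Num.min y b)| <= `|x - y|.
Proof.
wlog xy : x y / x <= y => [hw|].
  have [/hw//|/ltW /hw] := leP x y.
  by rewrite distrC (distrC x y).
rewrite (ler0_norm (_ : x - y <= 0)) ?subr_le0// ler_norml.
have [h1|h1] := leP x b; have [h2|h2] := leP y b;
  do 2?(case: (leP a _) => ?); apply/andP; split; lra.
Qed.

Lemma exists_Cprimitive (f : R -> R[i]) (c : R) :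
  continuous (fun y => complex.Re (f y)) -> continuous (fun y => complex.Im (f y)) ->
  exists G : R -> R[i],
    [/\ forall x, c < x -> is_derive x (1 : R) (fun y => complex.Re (G y)) (complex.Re (f x)),
        forall x, c < x -> is_derive x (1 : R) (fun y => complex.Im (G y)) (complex.Im (f x)) &
        forall s t, c < s -> s <= t ->
          Cintegral lebesgue_measure `[s, t] f = G t - G s].
Proof.
move=> cRe cIm.
have [A [dA AE]] := exists_primitive c cRe.
have [B [dB BE]] := exists_primitive c cIm.
exists (fun y => (A y +i* B y)%C); split => // s t cs st.
by rewrite /Cintegral AE// BE.
Qed.

End real_analysis.

(** * The coefficients of the two processes *)
Section spectral.
Context {R : realType} (sigma : probability (measurableTypeR R) R) (lam : nat -> R).
Hypothesis supp : supported_in sigma `[- 2^-1, 2^-1].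
Hypothesis lam0 : lam 0%N = 0.
Hypothesis onb : orthonormal_basisL2 sigma (fun n u => expi (lam n * u)).

Lemma expiN (x : R) : conjc (expi x) = expi (- x).
Proof. by rewrite /expi cosN sinN. Qed.

Lemma expiD (x y : R) : expi x * expi y = expi (x + y).
Proof. by rewrite /expi cosD sinD; apply/eqP; rewrite eq_complex /= addrC eqxx mulrC addrC eqxx. Qed.

Lemma normc_expi (x : R) : normc (expi x) = 1.
Proof. by rewrite /= cos2Dsin2 sqrtr1. Qed.

Lemma normc_expiB (x y : R) : normc (expi x - expi y) ^+ 2 = 2 - 2 * cos (x - y).
Proof.
rewrite normc_sq /= cosB.
have := cos2Dsin2 x; have := cos2Dsin2 y; move: (cos x) (sin x) (cos y) (sin y).
by move=> a b c e h1 h2; rewrite -[RHS]addr0 -[X in _ = X]addr0; lra.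
Qed.

Lemma cos_ge (x : R) : 2 - 2 * cos x <= x ^+ 2.
Proof.
rewrite -cos_norm -[x ^+ 2]real_normK ?num_real//.
have : 0 <= `|x| by [].
move: `|x| => y y0.
have -> : cos y = cos ((y / 2) *+ 2) by rewrite -mulrnAr -[2^-1 *+ 2]mulr_natr mulVf ?mulr1.
rewrite cos_mulr2n.
have z0 : 0 <= y / 2 by rewrite divr_ge0.
have [c _ E] := @MVT_segment R sin cos 0 (y / 2) z0 (fun x _ => is_derive_sin x)
  (@continuous_subspaceT _ _ _ _ (@continuous_sin R)).
rewrite sin0 !subr0 in E.
have h : sin (y / 2) ^+ 2 <= (y / 2) ^+ 2.
  rewrite E exprMn -[leRHS]mul1r ler_wpM2r ?sqr_ge0//.
by have := cos2Dsin2 (y / 2); lra.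
Qed.

Lemma measurable_trig (f : R -> R) (c : R) : continuous f ->
  measurable_fun [set: measurableTypeR R] (fun u : R => f (c * u)).
Proof.
move=> cf; apply: continuous_measurable_fun => x.
apply: continuous_comp; last exact: cf.
by apply: continuousM; [exact: cvg_cst|exact: cvg_id].
Qed.

Lemma Rint_trig (f : R -> R) (c : R) : continuous f -> (forall x, `|f x| <= 1) ->
  sigma.-integrable [set: measurableTypeR R] (EFin \o (fun u => f (c * u))).
Proof.
move=> cf f1; apply: measurable_bounded_integrable => //.
- exact: fin_num_fun_lty.
- exact: measurable_trig.
- exists 1; split => // x x1 u _ /=.
  by apply: le_trans (f1 _) _; exact: ltW.
Qed.

Lemma Cintegrable_expi (c : R) : Cintegrable sigma (fun u : R => expi (c * u)).
Proof.
split; apply: Rint_trig.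
- exact: continuous_cos.
- exact: cos_max.
- exact: continuous_sin.
- exact: sin_max.
Qed.

Lemma expi_mulJ (t : R) n : (fun u => expi (t * u) * conjc (expi (lam n * u)))
  = (fun u => expi ((t - lam n) * u)).
Proof. by apply/funext => u; rewrite expiN expiD mulrBl. Qed.

Lemma fourierE (t : R) n : fourier sigma (t - lam n) =
  Cintegral sigma [set: measurableTypeR R]
    (fun u => expi (t * u) * conjc (expi (lam n * u))).
Proof. by rewrite expi_mulJ. Qed.

Lemma onb_integrable m n :
  Cintegrable sigma (fun u => expi (lam m * u) * conjc (expi (lam n * u))).
Proof. by rewrite expi_mulJ; exact: Cintegrable_expi. Qed.

Lemma onb_orthonormal m n : Cintegral sigma [set: measurableTypeR R]
  (fun u => expi (lam m * u) * conjc (expi (lam n * u))) = (m == n)%:R.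
Proof. by have [_ + _] := onb; exact. Qed.

(** Bessel's inequality for [e^(i t u)], whose coefficients are the
    [fourier sigma (t - lam n)]. *)
Lemma sum_fourier_le1 (t : R) N :
  \sum_(n < N) normc (fourier sigma (t - lam n)) ^+ 2 <= 1 ^+ 2.
Proof.
under eq_bigr do rewrite fourierE.
have i1 : sigma.-integrable [set: measurableTypeR R]
    (EFin \o (fun u => normc (expi (t * u)) ^+ 2)).
  under eq_fun do rewrite normc_expi expr1n.
  exact: finite_measure_integrable_cst.
apply: le_trans (bessel _ onb_integrable onb_orthonormal _ i1) _.
  by move=> n; rewrite expi_mulJ; exact: Cintegrable_expi.
under eq_Rintegral do rewrite normc_expi.
by rewrite probability_Rintegral_cst.
Qed.

(** Here the support of the measure enters: [|e^(i t u) - e^(i s u)| <= |t - s|]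
    for [u] in the support. *)
Lemma sum_fourierB_le (t s : R) N :
  \sum_(n < N) normc (fourier sigma (t - lam n) - fourier sigma (s - lam n)) ^+ 2
    <= (t - s) ^+ 2.
Proof.
pose f u := expi (t * u) - expi (s * u).
have fJ n : (fun u => f u * conjc (expi (lam n * u))) =
   (fun u => expi ((t - lam n) * u) + (-1) * expi ((s - lam n) * u)).
  by apply/funext => u; rewrite /f mulrBl !expiN !expiD !mulrBl mulN1r.
have fE n : fourier sigma (t - lam n) - fourier sigma (s - lam n) =
    Cintegral sigma [set: measurableTypeR R]
      (fun u => f u * conjc (expi (lam n * u))).
  rewrite fJ CintegralD; [|exact: Cintegrable_expi|].
    by rewrite CintegralZ ?mulN1r//; exact: Cintegrable_expi.
  by apply: CintegrableZ; exact: Cintegrable_expi.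
under eq_bigr do rewrite fE.
have f2 u : normc (f u) ^+ 2 = 2 - 2 * cos ((t - s) * u).
  by rewrite normc_expiB mulrBl.
have i2 : sigma.-integrable [set: measurableTypeR R] (EFin \o (fun u => normc (f u) ^+ 2)).
  under eq_fun do rewrite f2.
  apply: RintB; first exact: finite_measure_integrable_cst.
  by apply: RintZ; apply: Rint_trig; [exact: continuous_cos|exact: cos_max].
apply: le_trans (bessel _ onb_integrable onb_orthonormal _ i2) _.
  move=> n; rewrite fJ; apply: CintegrableD; first exact: Cintegrable_expi.
  by apply: CintegrableZ; exact: Cintegrable_expi.
pose S : set (measurableTypeR R) := `[- 2^-1, 2^-1]%classic.
have mS : measurable S by exact: measurable_itv.
have -> : Rintegral sigma [set: measurableTypeR R] (fun u => normc (f u) ^+ 2) =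
    Rintegral sigma S (fun u => normc (f u) ^+ 2).
  congr fine; rewrite (@negligible_integral _ _ _ _ _ (~` S)) //.
    by rewrite setDE setCK setTI.
  exact: measurableC.
apply: (@le_trans _ _ (Rintegral sigma S (fun=> (t - s) ^+ 2))).
  apply: le_Rintegral => //.
  - exact: integrableS i2.
  - by apply: (integrableS measurableT) => //; exact: finite_measure_integrable_cst.
  - move=> u; rewrite /S /= in_itv /= => /andP[u1 u2].
    rewrite f2; apply: le_trans (cos_ge _) _.
    rewrite exprMn -[leRHS]mulr1 ler_wpM2l ?sqr_ge0//.
    nra.
rewrite Rintegral_cst// -[leRHS]mulr1 ler_wpM2l ?sqr_ge0//.
rewrite -lee_fin fineK ?fin_num_measure//.
exact: probability_le1.
Qed.

(** The single term [n = 0] of the previous sum, as [lam 0 = 0]. *)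
Lemma fourier_lipschitz (t s : R) :
  normc (fourier sigma t - fourier sigma s) <= `|t - s|.
Proof.
rewrite -(@ler_pXn2r _ 2)// ?nnegrE ?normc_ge0// real_normK ?num_real//.
by have := sum_fourierB_le t s 1; rewrite big_ord1 lam0 !subr0.
Qed.

(** The chaos coefficients of [W_sigma t] and [X_sigma t]. *)
Definition W_coef (t : R) : @fseries R :=
  linear_series (fun n => fourier sigma (t - lam n)).

Definition X_coef (t : R) : @fseries R :=
  linear_series (fun n => int_fourier sigma (lam n) t).

Lemma dnorm_W_coef t : dnorm_le 0 (W_coef t) 1.
Proof. by apply: dnorm_le_linear_series => N; exact: sum_fourier_le1. Qed.

Lemma dnorm_W_coefB t s : dnorm_le 0 (W_coef t - W_coef s) `|t - s|.
Proof.
rewrite /W_coef linear_seriesB; apply: dnorm_le_linear_series => N.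
by rewrite real_normK ?num_real//; exact: sum_fourierB_le.
Qed.

Lemma continuous_Re_fourier (l : R) : continuous (fun y => complex.Re (fourier sigma (y - l))).
Proof.
apply: (@continuous_lipschitz R _ 1) => s t; rewrite mul1r -raddfB.
apply: le_trans (normc_ge_Re _) _; apply: le_trans (fourier_lipschitz _ _) _.
by rewrite opprB addrA subrK.
Qed.

Lemma continuous_Im_fourier (l : R) : continuous (fun y => complex.Im (fourier sigma (y - l))).
Proof.
apply: (@continuous_lipschitz R _ 1) => s t; rewrite mul1r -raddfB.
apply: le_trans (normc_ge_Im _) _; apply: le_trans (fourier_lipschitz _ _) _.
by rewrite opprB addrA subrK.
Qed.

(** The increments of [X] differ from those of its linearization by a quadratic
    term, because [W] is Lipschitz and is the derivative of [X]. *)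
Lemma dnorm_X_coef_linearization s t : s <= t ->
  dnorm_le 0 (X_coef t - X_coef s - (fun al => ((t - s)%:C)%C * W_coef s al))
    ((t - s) * (t - s)).
Proof.
move=> st.
pose c := Num.min s 0 - 1.
have cs : c < s by rewrite /c ltrBlDr (@le_lt_trans _ _ s) ?ge_min ?lexx// ltrDl.
have c0 : c < 0 by rewrite /c ltrBlDr (@le_lt_trans _ _ 0) ?ge_min ?lexx ?orbT// add0r.
have /choice [G hG] : forall n, exists G : R -> R[i],
    [/\ forall x, c < x -> is_derive x (1 : R) (fun y => complex.Re (G y))
          (complex.Re (fourier sigma (x - lam n))),
        forall x, c < x -> is_derive x (1 : R) (fun y => complex.Im (G y))
          (complex.Im (fourier sigma (x - lam n))) &
        forall s t, c < s -> s <= t ->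
          Cintegral lebesgue_measure `[s, t] (fun y => fourier sigma (y - lam n)) = G t - G s].
  move=> n; apply: exists_Cprimitive; [exact: continuous_Re_fourier|exact: continuous_Im_fourier].
have XE n y : c < y -> int_fourier sigma (lam n) y = G n y - G n 0.
  move=> cy; have [_ _ h] := hG n; rewrite /int_fourier.
  case: ifPn => [y0|]; first by rewrite h.
  by rewrite -ltNge => y0; rewrite h ?ltW// opprB.
pose GG y := linear_series (G^~ y).
have -> : X_coef t - X_coef s = GG t - GG s.
  rewrite /X_coef /GG !linear_seriesB; congr linear_series; apply/funext => n.
  by rewrite !XE ?(lt_le_trans cs st)// opprB addrA subrK.
apply: (@dnorm_le_increment _ 0 GG W_coef) => //.
- by rewrite subr_ge0.
- move=> al x; rewrite in_itv /= => /andP[sx _].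
  have cx := lt_le_trans cs sx.
  have [[n ->]|no] := pselect (exists n, al = unit_index n).
    rewrite /GG /W_coef linear_series_unit.
    under eq_fun do rewrite linear_series_unit.
    by have [h _ _] := hG n; exact: h.
  have al0 m : al != unit_index m by apply/eqP => E; apply: no; exists m.
  rewrite /GG /W_coef linear_series0//.
  under eq_fun do rewrite linear_series0//.
  exact: is_derive_cst.
- move=> al x; rewrite in_itv /= => /andP[sx _].
  have cx := lt_le_trans cs sx.
  have [[n ->]|no] := pselect (exists n, al = unit_index n).
    rewrite /GG /W_coef linear_series_unit.
    under eq_fun do rewrite linear_series_unit.
    by have [_ h _] := hG n; exact: h.
  have al0 m : al != unit_index m by apply/eqP => E; apply: no; exists m.
  rewrite /GG /W_coef linear_series0//.
  under eq_fun do rewrite linear_series0//.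
  exact: is_derive_cst.
- move=> x; rewrite in_itv /= => /andP[sx xt].
  apply: dnorm_le_mono (dnorm_W_coefB _ _) => //.
  by rewrite ger0_norm ?subr_ge0// lerB.
Qed.

End spectral.

(** * Gaussian means of polynomials *)
Section gauss_mean.
Context {R : realType}.
Local Notation mu := (@lebesgue_measure R).
Implicit Types (q r : {poly R}).

Definition gauss_weighted q (x : R) : R := gauss_fun x * q.[x].

Lemma gauss_weightedE q (x : R) :
  gauss_weighted q x = expR (- x ^+ 2 / 2) * gauss_poly q x.
Proof.
rewrite /gauss_weighted /gauss_poly mulrA -expRD; congr (expR _ * _).
exact: splitr.
Qed.

Lemma continuous_gauss_weighted q : continuous (gauss_weighted q).
Proof.
by move=> x; apply: continuousM; [exact: continuous_gauss_fun|exact: continuous_horner].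
Qed.

Lemma integrable_half_gauss : mu.-integrable [set: R] (EFin \o (fun x : R => expR (- x ^+ 2 / 2))).
Proof.
have h := @integrable_normal_pdf R 0 1.
have -> : (fun x : R => expR (- x ^+ 2 / 2)) =
   (fun x : R => (normal_peak 1)^-1 * normal_pdf 0 1 x).
  apply/funext => x; rewrite normal_pdfE ?oner_neq0// /normal_fun.
  rewrite mulrA mulVf ?mul1r ?gt_eqF ?normal_peak_gt0 ?oner_neq0//.
  by rewrite subr0 expr1n.
exact: RintZ.
Qed.

Lemma integrable_gauss_weighted q : mu.-integrable [set: R] (EFin \o gauss_weighted q).
Proof.
have [M hM] := gauss_poly_bounded q.
apply: (le_integrable measurableT _ _ (RintZ M integrable_half_gauss)).
  apply/measurable_EFinP; apply: continuous_measurable_fun.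
  exact: continuous_gauss_weighted.
move=> x _ /=; rewrite lee_fin gauss_weightedE normrM mulrC [leRHS]normrM.
rewrite ler_wpM2r//; apply: le_trans (hM x) _; exact: ler_norm.
Qed.

(** The measure [e^(-x^2) dx] has mass [sqrt pi]; it is left unnormalized since
    the mean of a product is then the inner product in [L2(dx)] of two functions
    [gauss_poly]. *)
Definition gauss_mean q : R := Rintegral mu [set: R] (gauss_weighted q).

Lemma gauss_meanD q r : gauss_mean (q + r) = gauss_mean q + gauss_mean r.
Proof.
rewrite -RintegralD//; try exact: integrable_gauss_weighted.
by apply: eq_Rintegral => x _; rewrite /gauss_weighted hornerD mulrDr.
Qed.

Lemma gauss_meanZ (c : R) q : gauss_mean (c *: q) = c * gauss_mean q.
Proof.
rewrite -RintegralZl//; last exact: integrable_gauss_weighted.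
by apply: eq_Rintegral => x _; rewrite /gauss_weighted hornerZ mulrCA.
Qed.

Lemma gauss_mean1 : gauss_mean 1 = Num.sqrt pi.
Proof.
rewrite /gauss_mean /gauss_weighted.
under eq_Rintegral do rewrite hornerC mulr1.
by rewrite /Rintegral integralT_gauss.
Qed.

Lemma is_derive_gauss_weighted q (x : R) :
  is_derive x (1 : R) (gauss_weighted q) (gauss_weighted (q^`() - 2 *: ('X * q)) x).
Proof.
rewrite /gauss_weighted /gauss_fun.
apply: is_derive_eq.
rewrite !hornerE /GRing.scale /=.
by ring.
Qed.

(** One factor [e^(-x^2 / 2)] together with [x q] stays bounded, which leaves a
    decay of order [1 / x]. *)
Lemma cvg_gauss_weighted q (s : R) : `|s| = 1 ->
  gauss_weighted q (s * n.+1%:R) @[n --> \oo] --> (0 : R).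
Proof.
move=> s1.
have [M hM] := gauss_poly_bounded ('X * q).
apply/norm_cvg0P.
apply: (@squeeze_cvgr _ _ _ _ (fun=> 0) (fun n => M * n.+1%:R^-1)).
- apply: nearW => n; rewrite normr_ge0 /=.
  rewrite ler_pdivlMr ?ltr0n//.
  rewrite gauss_weightedE normrM mulrAC.
  have := hM (s * n.+1%:R); rewrite /gauss_poly hornerM hornerX !normrM s1 normr_nat mul1r.
  have e1 : `|expR (- (s * n.+1%:R) ^+ 2 / 2)| <= 1.
    by rewrite ger0_norm ?expR_ge0// -[leRHS]expR0 ler_expR mulNr oppr_le0 divr_ge0 ?sqr_ge0.
  move=> h; rewrite [leLHS](_ : _ = `|expR (- (s * n.+1%:R) ^+ 2 / 2)| *
     (`|expR (- (s * n.+1%:R) ^+ 2 / 2)| * (n.+1%:R * `|q.[s * n.+1%:R]|))).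
    apply: le_trans h; rewrite -[leRHS]mul1r ler_wpM2r//.
  by ring.
- exact: cvg_cst.
- rewrite -(mulr0 M); apply: cvgM; first exact: cvg_cst.
  exact: cvg_harmonic.
Qed.

(** Integration by parts against [e^(-x^2)] on growing intervals, the boundary
    terms tending to [0]. *)
Lemma gauss_mean_deriv q : gauss_mean q^`() = 2 * gauss_mean ('X * q).
Proof.
suff h : gauss_mean (q^`() - 2 *: ('X * q)) = 0.
  by apply/eqP; rewrite -subr_eq0 -gauss_meanZ -[X in _ + X]mulN1r -gauss_meanZ -gauss_meanD scaleN1r h.
set r := _ - _.
pose A n : set R := `[- n.+1%:R, n.+1%:R]%classic.
have FTC n : (\int[mu]_(x in A n) (gauss_weighted r x)%:E =
    (gauss_weighted q (1 * n.+1%:R) - gauss_weighted q (-1 * n.+1%:R))%:E)%E.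
  rewrite mul1r mulN1r /A EFinB; apply: continuous_FTC2.
  - by rewrite gtrN// ltr0n.
  - by apply: continuous_subspaceT; exact: continuous_gauss_weighted.
  - split.
    + by move=> x _; have [] := is_derive_gauss_weighted q x.
    + by apply: cvg_at_right_filter; exact: continuous_gauss_weighted.
    + by apply: cvg_at_left_filter; exact: continuous_gauss_weighted.
  - by move=> x _; rewrite derive1E; have [_ ->] := is_derive_gauss_weighted q x.
have mA n : measurable (A n) by exact: measurable_itv.
have ir := integrable_gauss_weighted r.
have mr : measurable_fun [set: R] (EFin \o gauss_weighted r) by case/integrableP : ir.
pose f (n : nat) : R -> \bar R := (EFin \o gauss_weighted r) \_ (A n).
have mf n : measurable_fun [set: R] (f n).
  exact: (measurable_restrictT _ (mA n)).1 (measurable_funTS mr).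
have f_cvg x : f ^~ x @ \oo --> (EFin \o gauss_weighted r) x.
  apply: cvg_near_cst; near=> n.
  rewrite /f patchE ifT// inE /A /= in_itv /= -ler_norml.
  near: n; exists (Num.truncn `|x|) => // n /= xn.
  apply/ltW/(lt_le_trans (truncnS_gt _)); rewrite ler_nat ltnS//.
have f_dom n x : (`|f n x| <= `|(EFin \o gauss_weighted r) x|)%E.
  by rewrite /f patchE; case: ifP => _ //; rewrite abse0.
have [||_ _] := @dominated_convergence _ _ R mu [set: R] measurableT
  f (EFin \o gauss_weighted r) _ mf mr _ (integrable_abse ir) _.
- by apply: aeW => x _; exact: f_cvg.
- by apply: aeW => x n _; exact: f_dom.
under eq_fun do rewrite -integral_mkcond FTC.
move=> lim.
have lim0 : (gauss_weighted q (1 * n.+1%:R) - gauss_weighted q (-1 * n.+1%:R))%:E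
    @[n --> \oo] --> (0%R)%:E.
  apply: cvg_EFin; first exact: nearW.
  rewrite -[0%R](subrr 0).
  apply: cvgB; apply: cvg_gauss_weighted; rewrite ?normr1// normrN1//.
rewrite /gauss_mean /Rintegral.
by rewrite (cvg_unique _ lim lim0).
Unshelve. all: by end_near. Qed.

End gauss_mean.

(** * Orthonormality of the Hermite functions *)
Section hermite_orthonormal.
Context {R : realType}.
Implicit Types (q r : {poly R}).
Local Notation He := (hermite_poly R).

Lemma deriv_hermite n : (He n.+1)^`() = n.+1%:R *: He n.
Proof.
elim: n => [|n IH]; first by rewrite /= derivC subr0 mulr1 derivX scale1r.
rewrite [He n.+2]/= -/(He n.+1) derivB derivM derivX mul1r IH derivZ.
rewrite -scalerAr -addrA -scalerBr -['X * _ - _]/(He n.+1).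
by rewrite -[X in X + _]scale1r -scalerDl nat1r.
Qed.

(** [hermite_fun n] is the Gaussian [e^(-x^2/2)] times this polynomial. *)
Definition hermite_factor n : {poly R} :=
  (Num.sqrt (Num.sqrt pi * n`!%:R))^-1 *: (He n \Po (Num.sqrt 2 *: 'X)).

Lemma hermite_funE n : hermite_fun n = gauss_poly (hermite_factor n).
Proof.
apply/funext => x; rewrite /hermite_fun /gauss_poly hornerZ horner_comp.
by rewrite hornerZ hornerX mulrCA mulrA.
Qed.

Let u n : {poly R} := He n \Po (Num.sqrt 2 *: 'X).

Let sqrt2_neq0 : Num.sqrt 2 != 0 :> R.
Proof. by rewrite gt_eqF// sqrtr_gt0. Qed.

Let deriv_u n : (u n)^`() = Num.sqrt 2 *: ((He n)^`() \Po (Num.sqrt 2 *: 'X)).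
Proof. by rewrite /u deriv_comp derivZ derivX -scalerAr mulr1. Qed.

(** Raising the degree is adjoint to differentiation, up to a constant. *)
Let gauss_mean_uS n r : gauss_mean (u n.+1 * r) = (Num.sqrt 2)^-1 * gauss_mean (u n * r^`()).
Proof.
have uS : u n.+1 = Num.sqrt 2 *: ('X * u n) - (Num.sqrt 2)^-1 *: (u n)^`().
  rewrite deriv_u scalerA mulVf// scale1r /u [He n.+1]/= comp_polyB comp_polyM comp_polyX.
  by rewrite -scalerAl.
have := gauss_mean_deriv (u n * r); rewrite derivM gauss_meanD mulrA => h.
rewrite uS mulrBl -!scalerAl -scaleN1r !(gauss_meanD, gauss_meanZ).
have s2 : Num.sqrt 2 * Num.sqrt 2 = 2 :> R by rewrite -expr2 sqr_sqrtr.
have -> : gauss_mean (u n * r^`()) = 2 * gauss_mean ('X * u n * r) - gauss_mean ((u n)^`() * r).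
  by rewrite -h addrC addKr.
move: (gauss_mean ('X * u n * r)) (gauss_mean ((u n)^`() * r)) => A B.
have -> : 2 * A = Num.sqrt 2 * (Num.sqrt 2 * A) by rewrite mulrA s2.
by rewrite mulrBr mulN1r mulKf.
Qed.

Let gauss_mean_u n m : gauss_mean (u n * u m) = (n == m)%:R * (n`!%:R * Num.sqrt pi).
Proof.
have u0 : u 0 = 1 by rewrite /u /= comp_polyC.
elim: n m => [|n IH] [|m].
- by rewrite u0 mul1r gauss_mean1 eqxx !mul1r.
- rewrite mulrC gauss_mean_uS u0 derivC mulr0 -(scale0r 1) gauss_meanZ.
  by rewrite mul0r mulr0 mul0r.
- rewrite gauss_mean_uS u0 derivC mulr0 -(scale0r 1) gauss_meanZ.
  by rewrite mul0r mulr0 mul0r.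
- rewrite gauss_mean_uS deriv_u deriv_hermite comp_polyZ -/(u m).
  rewrite -(scalerAr (Num.sqrt 2)) -(scalerAr m.+1%:R) !gauss_meanZ mulKf// IH eqSS.
  have [<-|_] := eqVneq n m; last by rewrite !mul0r mulr0.
  by rewrite !mul1r mulrA -natrM factS.
Qed.

(** The Hermite functions are orthonormal in L2(dx). *)
Lemma hermite_factor_orthonormal n m :
  gauss_mean (hermite_factor n * hermite_factor m) = (n == m)%:R.
Proof.
rewrite /hermite_factor -scalerAl -scalerAr !gauss_meanZ gauss_mean_u.
have [<-|_] := eqVneq n m; last by rewrite mul0r !mulr0.
have pi0 : 0 < Num.sqrt pi * n`!%:R :> R.
  by rewrite mulr_gt0 ?sqrtr_gt0 ?pi_gt0 ?ltr0n ?fact_gt0.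
by rewrite mul1r mulrA -invfM -expr2 sqr_sqrtr ?(ltW pi0)// mulrC [n`!%:R * _]mulrC divff// gt_eqF.
Qed.

End hermite_orthonormal.

(** * Moments and integration by parts for a Gaussian field *)
Section gaussian_field.
Context {R : realType} d (T : measurableType d) (P : probability T R).
Implicit Types (f g h k : T -> R).
Local Notation Rint f := (P.-integrable [set: T] (EFin \o f)).
Local Notation EE f := (Rintegral P [set: T] f).
Local Notation meas f := (measurable_fun [set: T] f).

Lemma Rint_measurable f : Rint f -> meas f.
Proof. by case/integrableP => /measurable_EFinP. Qed.

Lemma Rint_le f g : meas f -> (forall w, `|f w| <= g w) -> Rint g -> Rint f.
Proof.
move=> mf fg ig; apply: (le_integrable measurableT _ _ ig).
  exact/measurable_EFinP.
by move=> w _ /=; rewrite lee_fin (le_trans (fg w))// ler_norm.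
Qed.

Lemma Rint_bounded f g : Rint f -> meas g -> (forall w, `|g w| <= 1) ->
  Rint (fun w => f w * g w).
Proof.
move=> int_f mg g1.
apply: (@Rint_le _ (fun w => `|f w|)).
- by apply: measurable_funM => //; exact: Rint_measurable.
- by move=> w; rewrite normrM ler_piMr.
- exact: integrable_norm.
Qed.

Lemma meas_cos f : meas f -> meas (fun w => cos (f w)).
Proof.
move=> mf; apply: (measurableT_comp _ mf).
by apply: continuous_measurable_fun; exact: continuous_cos.
Qed.

Lemma meas_sin f : meas f -> meas (fun w => sin (f w)).
Proof.
move=> mf; apply: (measurableT_comp _ mf).
by apply: continuous_measurable_fun; exact: continuous_sin.
Qed.

Lemma meas_lin (x : R) h k : meas h -> meas k -> meas (fun w => x * h w + k w).
Proof. by move=> mh mk; apply: measurable_funD => //; exact: measurable_funM. Qed.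

(** The derivative in [y] of the integrand is dominated by [|g h|], uniformly in
    [y]. *)
Lemma trig_under_integral g h k (x : R) : Rint g -> Rint (fun w => g w * h w) ->
  meas h -> meas k ->
  is_derive x (1 : R) (fun y : R => EE (fun w => g w * cos (y * h w + k w)))
    (EE (fun w => - (g w * h w * sin (x * h w + k w)))).
Proof.
move=> ig igh mh mk.
pose f (y : R) w := g w * cos (y * h w + k w).
have df y w : is_derive y (1 : R) (f ^~ w) (- (g w * h w * sin (y * h w + k w))).
  rewrite /f; apply: is_derive_eq; rewrite /GRing.scale /=; ring.
have pf y w : partial1of2 f y w = - (g w * h w * sin (y * h w + k w)).
  by rewrite partial1of2E; have [_ ->] := df y w.
pose G w := `|g w * h w|.
have Ix : `]x - 1, x + 1[%classic x by rewrite /= in_itv /= ltrBlDr !ltrDl ltr01.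
have intf (y : R) : `]x - 1, x + 1[%classic y -> P.-integrable [set: T] (EFin \o f y).
  move=> _; apply: Rint_bounded => //; last by move=> w; exact: cos_max.
  by apply: meas_cos; exact: meas_lin.
have derf (y : R) w : `]x - 1, x + 1[%classic y -> [set: T] w -> derivable (f ^~ w) y 1.
  by move=> _ _; have [] := df y w.
have G0 w : 0 <= G w by exact: normr_ge0.
have intG : P.-integrable [set: T] (EFin \o G) by exact: integrable_norm.
have Gub (y : R) w : `]x - 1, x + 1[%classic y -> [set: T] w -> `|partial1of2 f y w| <= G w.
  by move=> _ _; rewrite pf normrN normrM ler_piMr// sin_max.
apply: DeriveDef.
  exact: (derivable_under_integral measurableT Ix intf derf G0 intG Gub).
rewrite -derive1E.
rewrite (differentiation_under_integral measurableT Ix intf derf G0 intG Gub).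
by apply: eq_Rintegral => w _; rewrite -pf.
Qed.

Lemma cos_le (u : R) : `|u| <= 1 -> u ^+ 2 / 4 <= 1 - cos u.
Proof.
rewrite -cos_norm -[u ^+ 2]real_normK ?num_real//.
have : 0 <= `|u| by [].
move: `|u| => y y0 y1.
have -> : cos y = cos ((y / 2) *+ 2) by rewrite -mulrnAr -[2^-1 *+ 2]mulr_natr mulVf ?mulr1.
rewrite cos_mulr2n.
have z0 : 0 <= y / 2 by rewrite divr_ge0.
have [c cy E] := @MVT_segment R sin cos 0 (y / 2) z0 (fun x _ => is_derive_sin x)
  (@continuous_subspaceT _ _ _ _ (@continuous_sin R)).
rewrite sin0 !subr0 in E.
move: cy; rewrite in_itv /= => /andP[c0 cy].
have c2 : c ^+ 2 <= 1 / 4 by nra.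
have cosc : 7 / 8 <= cos c by have := cos_ge c; lra.
have h : (3 / 4) * (y / 2) ^+ 2 <= sin (y / 2) ^+ 2.
  rewrite E [leRHS]exprMn ler_wpM2r ?sqr_ge0//.
  by move: (cos c) cosc => z cz; nra.
by have := cos2Dsin2 (y / 2); have := sqr_ge0 y; lra.
Qed.

(** By monotone convergence: [1 - cos u >= u^2 / 4] near [0], so a quadratic bound on
    the increment at [0] of [x |-> E (g cos (x h))] makes [g h^2] integrable. *)
Lemma second_moment_integrable g h (K : R) : (forall w, 0 <= g w) -> Rint g -> meas h ->
  (forall x : R, 0 < x -> EE (fun w => g w * (1 - cos (x * h w))) <= K * x ^+ 2) ->
  Rint (fun w => g w * h w ^+ 2).
Proof.
move=> g0 ig mh hK.
have mg := Rint_measurable ig.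
have mgh : meas (fun w => g w * h w ^+ 2).
  by apply: measurable_funM => //; exact: measurable_funX.
apply/integrableP; split; first exact/measurable_EFinP.
pose S (n : nat) : set T := [set w | `|h w| <= n.+1%:R].
have mS n : measurable (S n).
  rewrite (_ : S n = (fun w => `|h w|) @^-1` `]-oo, n.+1%:R]).
    rewrite -[X in measurable X]setTI; apply: (measurableT_comp (@normr_measurable R setT) mh) => //.
  by apply/seteqP; split=> w /=; rewrite /S in_itv.
pose F (n : nat) (w : T) : \bar R := (g w * h w ^+ 2 * \1_(S n) w)%:E.
have mF n : measurable_fun [set: T] (F n).
  apply/measurable_EFinP; apply: measurable_funM => //.
have F0 n w : [set: T] w -> (0 <= F n w)%E.
  by move=> _; rewrite lee_fin mulr_ge0// mulr_ge0// sqr_ge0.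
have ndF w : [set: T] w -> nondecreasing_seq (F ^~ w).
  move=> _ m n mn; rewrite lee_fin ler_wpM2l//; first by rewrite mulr_ge0// sqr_ge0.
  rewrite !indicE; have [wm|//] := boolP (w \in S m).
  rewrite mem_set// /S /=; move: wm; rewrite inE /S /= => wm.
  by apply: le_trans wm _; rewrite ler_nat.
have limF w : (limn (F ^~ w) = (g w * h w ^+ 2)%:E)%E.
  apply/cvg_lim => //; apply: cvg_near_cst; near=> n.
  rewrite /F indicE mem_set ?mulr1// /S /=.
  near: n; exists (Num.truncn `|h w|) => // n /= hn.
  by apply/ltW/(lt_le_trans (truncnS_gt _)); rewrite ler_nat ltnS.
have gcos0 (x : R) w : 0 <= g w * (1 - cos (x * h w)).
  by rewrite mulr_ge0// subr_ge0 cos_le1.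
have bndF n : (\int[P]_w F n w <= (4 * K)%:E)%E.
  have n0 : 0 < n.+1%:R :> R by rewrite ltr0n.
  have ic : Rint (fun w => g w * (1 - cos (n.+1%:R^-1 * h w))).
    have -> : (fun w => g w * (1 - cos (n.+1%:R^-1 * h w))) =
       (fun w => g w - g w * cos (n.+1%:R^-1 * h w)).
      by apply/funext => w; rewrite mulrBr mulr1.
    apply: RintB => //; apply: Rint_bounded => //; last by move=> w; exact: cos_max.
    by apply: meas_cos; exact: measurable_funM.
  apply: (@le_trans _ _ (\int[P]_w (4 * n.+1%:R ^+ 2 * (g w * (1 - cos (n.+1%:R^-1 * h w))))%:E)%E).
    apply: ge0_le_integral => //.
    - by move=> w _; rewrite lee_fin mulr_ge0 ?gcos0// mulr_ge0// sqr_ge0.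
    - by apply/measurable_EFinP; exact: Rint_measurable (RintZ _ ic).
    move=> w _; rewrite lee_fin [leRHS]mulrCA -[leLHS]mulrA ler_wpM2l//.
    rewrite indicE; have [wS|wS] := boolP (w \in S n); last first.
      by rewrite mulr0 mulr_ge0 ?mulr_ge0 ?sqr_ge0 ?subr_ge0 ?cos_le1.
    rewrite mulr1; move: wS; rewrite inE /S /= => wS.
    have := @cos_le (n.+1%:R^-1 * h w).
    rewrite normrM normfV normr_nat ler_pdivrMl// mulr1 => /(_ wS).
    rewrite exprMn exprVn ler_pdivrMr// => le1.
    rewrite ler_pdivrMl ?exprn_gt0// in le1.
    by apply: le_trans le1 _; rewrite mulrA mulrC mulrA.
  have -> : (\int[P]_w (4 * n.+1%:R ^+ 2 * (g w * (1 - cos (n.+1%:R^-1 * h w))))%:E)%E =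
     (EE (fun w => 4 * n.+1%:R ^+ 2 * (g w * (1 - cos (n.+1%:R^-1 * h w)))))%:E.
    by rewrite /Rintegral fineK//; apply: integrable_fin_num => //; exact: RintZ.
  rewrite lee_fin RintegralZl// -mulrA ler_wpM2l//.
  have xn : 0 < n.+1%:R^-1 :> R by rewrite invr_gt0.
  by rewrite -ler_pdivlMl ?exprn_gt0// mulrC -exprVn; exact: hK.
have -> : (\int[P]_w `|(EFin \o (fun w => g w * h w ^+ 2)%R) w| = \int[P]_w limn (F ^~ w))%E.
  apply: eq_integral => w _; rewrite limF /=.
  by rewrite ger0_norm// mulr_ge0// sqr_ge0.
rewrite (monotone_convergence P measurableT mF F0 ndF).
apply: (@le_lt_trans _ _ (4 * K)%:E); last exact: ltry.
apply: lime_le; last exact: nearW.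
apply: ereal_nondecreasing_is_cvgn => m n mn; apply: ge0_le_integral => //.
- by move=> w _; exact: F0.
- by move=> w _; exact: ndF.
Unshelve. all: by end_near. Qed.

(** Even moments are enough, as they control the others; such functions form an
    algebra. *)
Definition all_moments f := meas f /\ forall n, Rint (fun w => f w ^+ (2 * n)).

Lemma all_moments_Rint f : all_moments f -> Rint f.
Proof.
move=> [mf hf]; apply: (@Rint_le _ (fun w => 1 + f w ^+ (2 * 1))) => //.
  move=> w; rewrite muln1 -[f w ^+ 2]real_normK ?num_real//.
  by have := sqr_ge0 (`|f w| - 1); have := normr_ge0 (f w); nra.
by apply: RintD; [exact: finite_measure_integrable_cst|exact: hf].
Qed.

Lemma all_moments_cst (c : R) : all_moments (fun=> c).
Proof. by split=> // n; exact: finite_measure_integrable_cst. Qed.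

Lemma all_momentsM f g : all_moments f -> all_moments g ->
  all_moments (fun w => f w * g w).
Proof.
move=> [mf hf] [mg hg].
have mfg : meas (fun w => f w * g w) by exact: measurable_funM.
split=> // n.
apply: (@Rint_le _ (fun w => f w ^+ (2 * (2 * n)) + g w ^+ (2 * (2 * n)))).
- exact: measurable_funX.
- move=> w; rewrite ger0_norm; last by rewrite exprM exprn_ge0// sqr_ge0.
  rewrite exprMn mulnA (mulnC 2 2) -mulnA !exprM -!exprM.
  rewrite ![(2 * (2 * n))%N]mulnC !exprM.
  move: (f w ^+ (2 * n)) (g w ^+ (2 * n)) => x y.
  have := sqr_ge0 (x - y); have := sqr_ge0 (x + y); nra.
- by apply: RintD.
Qed.

Lemma all_momentsD f g : all_moments f -> all_moments g ->
  all_moments (fun w => f w + g w).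
Proof.
move=> [mf hf] [mg hg].
have mfg : meas (fun w => f w + g w) by exact: measurable_funD.
split=> // n.
apply: (@Rint_le _ (fun w => 4 ^+ n * (f w ^+ (2 * n) + g w ^+ (2 * n)))).
- exact: measurable_funX.
- move=> w; rewrite ger0_norm; last by rewrite exprM exprn_ge0// sqr_ge0.
  rewrite !exprM.
  have sq : (f w + g w) ^+ 2 <= 4 * Num.max (f w ^+ 2) (g w ^+ 2).
    have h1 : f w ^+ 2 <= Num.max (f w ^+ 2) (g w ^+ 2) by rewrite le_max lexx.
    have h2 : g w ^+ 2 <= Num.max (f w ^+ 2) (g w ^+ 2) by rewrite le_max lexx orbT.
    by have := sqr_ge0 (f w - g w); nra.
  apply: (@le_trans _ _ ((4 * Num.max (f w ^+ 2) (g w ^+ 2)) ^+ n)).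
    by rewrite lerXn2r// ?nnegrE ?sqr_ge0// mulr_ge0// le_max sqr_ge0.
  rewrite exprMn ler_wpM2l ?exprn_ge0//.
  by have [_|_] := leP (f w ^+ 2) (g w ^+ 2); rewrite ?lerDl ?lerDr exprn_ge0// sqr_ge0.
- by apply: RintZ; exact: RintD.
Qed.

Lemma all_moments_bounded f g : all_moments f -> meas g -> (forall w, `|g w| <= 1) ->
  Rint (fun w => f w * g w).
Proof. by move=> /all_moments_Rint ? ? ?; exact: Rint_bounded. Qed.

Lemma all_moments_horner (p : {poly R}) f : all_moments f ->
  all_moments (fun w => p.[f w]).
Proof.
move=> hf; elim/poly_ind : p => [|p c IH].
  by under eq_fun do rewrite horner0; exact: all_moments_cst.
under eq_fun do rewrite hornerMXaddC.
by apply: all_momentsD; [exact: all_momentsM|exact: all_moments_cst].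
Qed.

Lemma all_moments_prod (I : Type) (r : seq I) (F : I -> T -> R) :
  (forall i, all_moments (F i)) -> all_moments (fun w => \prod_(i <- r) F i w).
Proof.
move=> hF; elim: r => [|i r IH].
  by under eq_fun do rewrite big_nil; exact: all_moments_cst.
by under eq_fun do rewrite big_cons; exact: all_momentsM.
Qed.

(** By induction, [h^(2 n)] is integrable and the cosine transform of its law is
    some [gauss_poly q]. Such functions are bounded and closed under
    differentiation, so the transform has a quadratic maximum at [0]; this yields
    the next even moment, whose transform is minus the second derivative. *)
Lemma standard_normal_moments h : meas h ->
  (forall x : R, EE (fun w => cos (x * h w)) = expR (- x ^+ 2 / 2)) ->
  all_moments h.
Proof.
move=> mh charh; split=> // n.
suff [] : Rint (fun w => h w ^+ (2 * n)) /\ exists q : {poly R}, forall x : R,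
  EE (fun w => h w ^+ (2 * n) * cos (x * h w)) = gauss_poly q x by [].
elim: n => [|n [ih [q qE]]].
  split; first by under eq_fun do rewrite muln0 expr0; exact: finite_measure_integrable_cst.
  exists 1 => x; rewrite /gauss_poly hornerC mulr1 -charh.
  by apply: eq_Rintegral => w _; rewrite muln0 expr0 mul1r.
set g := fun w => h w ^+ (2 * n) in ih qE.
have mg : meas g by exact: measurable_funX.
have g0 w : 0 <= g w by rewrite /g exprM exprn_ge0// sqr_ge0.
pose q1 := q^`() - 'X * q.
pose q2 := q1^`() - 'X * q1.
have [K hK] := gauss_poly_bounded q2.
have igc (x : R) : Rint (fun w => g w * cos (x * h w)).
  apply: Rint_bounded => //; last by move=> w; exact: cos_max.
  by apply: meas_cos; exact: measurable_funM.
have incr (x : R) : EE (fun w => g w * (1 - cos (x * h w))) = gauss_poly q 0 - gauss_poly q x.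
  rewrite -!qE -RintegralB//.
  apply: eq_Rintegral => w _; by rewrite mul0r cos0 mulrBr.
have d1 (y : R) := is_derive_gauss_poly q y.
have d2 (y : R) := is_derive_gauss_poly q1 y.
have q10 : gauss_poly q1 0 = 0.
  have max0 : is_derive (0 : R) (1 : R) (gauss_poly q) 0.
    apply: (@derive1_at_max _ _ (-1) 1).
    - by rewrite -subr_ge0 opprK addr_ge0.
    - by move=> t _; have [] := d1 t.
    - by rewrite in_itv /= ltrN10 ltr01.
    - move=> t _; rewrite -subr_ge0 -incr; apply: Rintegral_ge0 => w _.
      by rewrite mulr_ge0// subr_ge0 cos_le1.
  have [_ <-] := d1 0; by have [_ ->] := max0.
have quad (x : R) : 0 < x -> EE (fun w => g w * (1 - cos (x * h w))) <= K * x ^+ 2.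
  move=> x0; rewrite incr.
  have cont (r : {poly R}) (u v : R) : {within `[u, v], continuous (gauss_poly r)}.
    by apply: derivable_within_continuous => y _; have [] := is_derive_gauss_poly r y.
  have [c cx E] := @MVT_segment R (gauss_poly q) (gauss_poly q1) 0 x (ltW x0)
     (fun y _ => d1 y) (cont q 0 x).
  move: cx; rewrite in_itv /= => /andP[c0 cx].
  have [e ec E2] := @MVT_segment R (gauss_poly q1) (gauss_poly q2) 0 c c0
     (fun y _ => d2 y) (cont q1 0 c).
  rewrite q10 !subr0 in E2; rewrite subr0 in E.
  have -> : gauss_poly q 0 - gauss_poly q x = - (gauss_poly q2 e * c * x).
    by rewrite -E2 -E opprB.
  have K0 : 0 <= K by apply: le_trans (hK 0).
  have : - gauss_poly q2 e <= K by apply: le_trans (hK e); rewrite -normrN ler_norm.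
  move: (gauss_poly q2 e) => t tK.
  rewrite -!mulNr expr2 mulrA ler_wpM2r ?(ltW x0)//.
  apply: (@le_trans _ _ (K * c)); last by rewrite ler_wpM2l.
  by rewrite ler_wpM2r.
have ih2 : Rint (fun w => g w * h w ^+ 2) by exact: second_moment_integrable quad.
have mgh : meas (fun w => g w * h w) by exact: measurable_funM.
have ih1 : Rint (fun w => g w * h w).
  apply: (@Rint_le _ (fun w => g w + g w * h w ^+ 2)) => //; last exact: RintD.
  move=> w; rewrite normrM (ger0_norm (g0 w)) -[X in X + _]mulr1 -mulrDr ler_wpM2l//.
  rewrite -[h w ^+ 2]real_normK ?num_real//.
  by have := sqr_ge0 (`|h w| - 1); have := normr_ge0 (h w); nra.
split; first by under eq_fun do rewrite mulnS addnC exprD.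
exists (- q2) => x.
have m0 (c : R) : meas (fun=> c) by [].
have first (y : R) : EE (fun w => g w * h w * cos (y * h w + (- (pi / 2)))) = - gauss_poly q1 y.
  have D := trig_under_integral y ih ih1 mh (m0 0).
  have [_ E1] := D; have [_ <-] := d1 y.
  have -> : gauss_poly q = (fun y : R => EE (fun w => g w * cos (y * h w + 0))).
    by apply/funext => z; rewrite -qE; apply: eq_Rintegral => w _; rewrite addr0.
  rewrite E1 -[RHS]mulN1r -RintegralZl//; last first.
    under eq_fun do rewrite -mulN1r; apply: RintZ.
    apply: Rint_bounded => //; last by move=> w; exact: sin_max.
    by apply: meas_sin; exact: meas_lin.
  apply: eq_Rintegral => w _; rewrite mulN1r opprK addr0; congr (_ * _).
  by rewrite cosBpihalf.
have ihh : Rint (fun w => g w * h w * h w) by under eq_fun do rewrite -mulrA -expr2.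
have D := trig_under_integral x ih1 ihh mh (m0 (- (pi / 2))).
have dN : is_derive x (1 : R) (fun y => - gauss_poly q1 y) (- gauss_poly q2 x).
  by apply: is_deriveN; exact: d2.
have -> : gauss_poly (- q2) x = - gauss_poly q2 x by rewrite /gauss_poly hornerN mulrN.
have [_ <-] := dN; rewrite -(_ : (fun y : R => EE (fun w => g w * h w * cos (y * h w + (- (pi / 2))))) =
  (fun y => - gauss_poly q1 y)); last by apply/funext => y; exact: first.
have [_ ->] := D; apply: eq_Rintegral => w _.
by rewrite sinBpihalf mulrN opprK mulnS addnC exprD expr2 !mulrA.
Qed.

(** A centred Gaussian field [A] with covariance [B], given by its
    characteristic function, and an orthonormal sequence [v]. *)
Context (V : lmodType R) (A : V -> T -> R) (B : V -> V -> R) (v : nat -> V).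
Hypothesis mA : forall q, meas (A q).
Hypothesis linA : forall c q r w, A (c *: q + r) w = c * A q w + A r w.
Hypothesis BC : forall q r, B q r = B r q.
Hypothesis linB : forall c q r s, B (c *: q + r) s = c * B q s + B r s.
Hypothesis charA : forall q theta,
  EE (fun w => cos (A q w + theta)) = cos theta * expR (- B q q / 2).
Hypothesis orth : forall n m, B (v n) (v m) = (n == m)%:R.

Lemma gaussian_field0 w : A 0 w = 0.
Proof.
have := linA 1 0 0 w; rewrite scale1r addr0 mul1r => h.
by apply: (@addrI _ (A 0 w)); rewrite addr0 -h.
Qed.

Lemma covariance0 r : B 0 r = 0.
Proof.
have := linB 1 0 0 r; rewrite scale1r addr0 mul1r => h.
by apply: (@addrI _ (B 0 r)); rewrite addr0 -h.
Qed.

Lemma covariance_shift q n (y : R) :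
  B (y *: v n + q) (y *: v n + q) = B q q + 2 * y * B (v n) q + y ^+ 2.
Proof.
rewrite linB !(BC _ (y *: v n + q)) !linB orth eqxx (BC q (v n)) /=; ring.
Qed.

Lemma all_moments_coord n : all_moments (A (v n)).
Proof.
apply: standard_normal_moments => // x.
have -> : (fun w => cos (x * A (v n) w)) = (fun w => cos (A (x *: v n + 0) w + 0)).
  by apply/funext => w; rewrite linA gaussian_field0 !addr0.
by rewrite charA cos0 mul1r covariance_shift covariance0 BC covariance0 mulr0 !add0r.
Qed.

(** Gaussian integration by parts: [g'] is the derivative of [g] along the
    [n]-th coordinate. The extra trigonometric factor makes this stable under
    multiplication by coordinates, by differentiation in [q]. *)
Definition stein n g g' := [/\ all_moments g, all_moments g' &
  forall q theta, EE (fun w => A (v n) w * g w * cos (A q w + theta)) =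
    EE (fun w => g' w * cos (A q w + theta))
    - B (v n) q * EE (fun w => g w * sin (A q w + theta))].

Lemma meas_phase q (theta : R) : meas (fun w => A q w + theta).
Proof. exact: measurable_funD. Qed.

Lemma sin_shift (x theta : R) : sin (x + (theta + pi / 2)) = cos (x + theta).
Proof. by rewrite addrA sinDpihalf. Qed.

Lemma cos_shift (x theta : R) : cos (x + (theta + pi / 2)) = - sin (x + theta).
Proof. by rewrite addrA cosDpihalf. Qed.

Lemma RintegralN f : Rint f -> EE (fun w => - f w) = - EE f.
Proof.
by move=> h; under eq_Rintegral do rewrite -mulN1r; rewrite RintegralZl// mulN1r.
Qed.

Lemma Rint_cos g q theta : all_moments g -> Rint (fun w => g w * cos (A q w + theta)).
Proof.
move=> hg; apply: all_moments_bounded => //; last by move=> w; exact: cos_max.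
by apply: meas_cos; exact: meas_phase.
Qed.

Lemma Rint_sin g q theta : all_moments g -> Rint (fun w => g w * sin (A q w + theta)).
Proof.
move=> hg; apply: all_moments_bounded => //; last by move=> w; exact: sin_max.
by apply: meas_sin; exact: meas_phase.
Qed.

(** Moving the phase along [v m] is what brings down a factor [A (v m)]. *)
Lemma phase_derivative g m q (theta : R) : all_moments g ->
  is_derive (0 : R) (1 : R)
    (fun y : R => EE (fun w => g w * cos (A (y *: v m + q) w + theta)))
    (- EE (fun w => A (v m) w * g w * sin (A q w + theta))).
Proof.
move=> hg.
have hgm := all_momentsM hg (all_moments_coord m).
have := trig_under_integral 0 (all_moments_Rint hg) (all_moments_Rint hgm)
  (mA (v m)) (meas_phase q theta).
have -> : (fun y : R => EE (fun w => g w * cos (y * A (v m) w + (A q w + theta)))) =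
  (fun y : R => EE (fun w => g w * cos (A (y *: v m + q) w + theta))).
  apply/funext => y; apply: eq_Rintegral => w _.
  by rewrite linA addrA.
rewrite RintegralN; last first.
  under eq_fun do rewrite mul0r add0r; exact: Rint_sin.
congr is_derive; congr (- _); apply: eq_Rintegral => w _.
by rewrite mul0r add0r (mulrC (g w)).
Qed.

(** The formula [charA], differentiated in [q] along [v n]. *)
Lemma stein1 n : stein n (fun=> 1) (fun=> 0).
Proof.
split; [exact: all_moments_cst|exact: all_moments_cst|move=> q theta].
have D := phase_derivative n q (theta + pi / 2) (all_moments_cst 1).
pose e (y : R) := - B q q / 2 - y * B (v n) q - y ^+ 2 / 2.
have D2 : is_derive (0 : R) (1 : R) (fun y : R => cos (theta + pi / 2) * expR (e y))
    (- B (v n) q * (cos (theta + pi / 2) * expR (- B q q / 2))).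
  rewrite /e; apply: is_derive_eq; rewrite /GRing.scale /=.
  rewrite mul0r !subr0 expr0n /= !(mul0r, mulr0) subr0; ring.
have E : (fun y : R => EE (fun w => 1 * cos (A (y *: v n + q) w + (theta + pi / 2)))) =
    (fun y : R => cos (theta + pi / 2) * expR (e y)).
  apply/funext => y; under eq_Rintegral do rewrite mul1r.
  rewrite charA covariance_shift /e; congr (_ * expR _).
  by field.
rewrite E in D; have [_ h1] := D; have [_ h2] := D2; rewrite h1 in h2.
rewrite -charA in h2.
have h3 : EE (fun w => A (v n) w * 1 * cos (A q w + theta)) =
   EE (fun w => A (v n) w * 1 * sin (A q w + (theta + pi / 2))).
  by apply: eq_Rintegral => w _; rewrite sin_shift.
rewrite h3 -[LHS]opprK h2.
under [in RHS]eq_Rintegral do rewrite mul0r.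
have -> : EE (fun w => cos (A q w + (theta + pi / 2))) = - EE (fun w => 1 * sin (A q w + theta)).
  rewrite -RintegralN; last exact: Rint_sin (all_moments_cst 1).
  by apply: eq_Rintegral => w _; rewrite cos_shift mul1r.
by rewrite probability_Rintegral_cst; ring.
Qed.

(** The identity for [g], differentiated in [q] along [v m]. *)
Lemma steinZ n m g g' : stein n g g' ->
  stein n (fun w => A (v m) w * g w) (fun w => A (v m) w * g' w + (n == m)%:R * g w).
Proof.
move=> [hg hg' h].
have hz := all_moments_coord.
split.
- exact: all_momentsM.
- by apply: all_momentsD; apply: all_momentsM => //; exact: all_moments_cst.
move=> q theta.
have hzg := all_momentsM (hz n) hg.
have D1 := phase_derivative m q (theta + pi / 2) hzg.
pose F2 (y : R) := EE (fun w => g' w * cos (A (y *: v m + q) w + (theta + pi / 2))).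
pose F3 (y : R) := EE (fun w => g w * cos (A (y *: v m + q) w + theta)).
have E : (fun y : R => EE (fun w => A (v n) w * g w * cos (A (y *: v m + q) w + (theta + pi / 2)))) =
  (fun y : R => F2 y - (B (v n) q + y * (n == m)%:R) * F3 y).
  apply/funext => y; rewrite h (BC (v n)) linB (BC q) (BC (v m)) orth addrC.
  by under [in X in _ * X]eq_Rintegral do rewrite sin_shift; rewrite (addrC (y * _)) addrC.
rewrite E in D1; have [_ h1] := D1.
have D2 : is_derive (0 : R) (1 : R) F2 _ := phase_derivative m q (theta + pi / 2) hg'.
have D3 : is_derive (0 : R) (1 : R) F3 _ := phase_derivative m q theta hg.
have D4 : is_derive (0 : R) (1 : R) (fun y => F2 y - (B (v n) q + y * (n == m)%:R) * F3 y)
   (- EE (fun w => A (v m) w * g' w * sin (A q w + (theta + pi / 2)))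
    - ((n == m)%:R * F3 0 + B (v n) q *
       - EE (fun w => A (v m) w * g w * sin (A q w + theta)))).
  clear D1 h1 E; clearbody F2 F3.
  apply: is_derive_eq; rewrite /GRing.scale /=; ring.
have [_ h4] := D4.
rewrite h1 in h4; move: h4.
have F30 : F3 0 = EE (fun w => g w * cos (A q w + theta)).
  by rewrite /F3; apply: eq_Rintegral => w _; rewrite scale0r add0r.
rewrite F30.
under eq_Rintegral do rewrite sin_shift.
under [in X in _ = - X - _]eq_Rintegral do rewrite sin_shift.
move=> h4.
have -> : EE (fun w => A (v n) w * (A (v m) w * g w) * cos (A q w + theta)) =
  EE (fun w => A (v m) w * (A (v n) w * g w) * cos (A q w + theta)).
  by apply: eq_Rintegral => w _; rewrite mulrCA.
have -> : EE (fun w => (A (v m) w * g' w + (n == m)%:R * g w) * cos (A q w + theta)) =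
  EE (fun w => A (v m) w * g' w * cos (A q w + theta)) + (n == m)%:R * EE (fun w => g w * cos (A q w + theta)).
  rewrite -RintegralZl//; last exact: Rint_cos.
  rewrite -RintegralD//.
  - by apply: eq_Rintegral => w _; rewrite mulrDl mulrA.
  - by apply: Rint_cos; exact: all_momentsM.
  - by apply: RintZ; exact: Rint_cos.
by apply: oppr_inj; rewrite h4; ring.
Qed.

Lemma steinD n c g1 g1' g2 g2' : stein n g1 g1' -> stein n g2 g2' ->
  stein n (fun w => g1 w + c * g2 w) (fun w => g1' w + c * g2' w).
Proof.
move=> [a1 b1 h1] [a2 b2 h2].
have hc := all_moments_cst c.
have hz := all_moments_coord.
split.
- by apply: all_momentsD => //; exact: all_momentsM.
- by apply: all_momentsD => //; exact: all_momentsM.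
move=> q theta.
have -> : EE (fun w => A (v n) w * (g1 w + c * g2 w) * cos (A q w + theta)) =
   EE (fun w => A (v n) w * g1 w * cos (A q w + theta)) +
   c * EE (fun w => A (v n) w * g2 w * cos (A q w + theta)).
  have i1 := Rint_cos q theta (all_momentsM (hz n) a1).
  have i2 := Rint_cos q theta (all_momentsM (hz n) a2).
  rewrite -RintegralZl// -RintegralD//; last exact: RintZ.
  by apply: eq_Rintegral => w _; ring.
have -> : EE (fun w => (g1' w + c * g2' w) * cos (A q w + theta)) =
   EE (fun w => g1' w * cos (A q w + theta)) +
   c * EE (fun w => g2' w * cos (A q w + theta)).
  have i1 := Rint_cos q theta b1.
  have i2 := Rint_cos q theta b2.
  rewrite -RintegralZl// -RintegralD//; last exact: RintZ.
  by apply: eq_Rintegral => w _; ring.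
have -> : EE (fun w => (g1 w + c * g2 w) * sin (A q w + theta)) =
   EE (fun w => g1 w * sin (A q w + theta)) +
   c * EE (fun w => g2 w * sin (A q w + theta)).
  have i1 := Rint_sin q theta a1.
  have i2 := Rint_sin q theta a2.
  rewrite -RintegralZl// -RintegralD//; last exact: RintZ.
  by apply: eq_Rintegral => w _; ring.
by rewrite h1 h2; ring.
Qed.

Lemma stein_horner n m (p : {poly R}) g g' : stein n g g' ->
  stein n (fun w => p.[A (v m) w] * g w)
    (fun w => p.[A (v m) w] * g' w + (n == m)%:R * (p^`().[A (v m) w] * g w)).
Proof.
move=> h; elim/poly_ind : p => [|p c IH].
  have := steinD (-1) h h.
  by congr stein; apply/funext => w; rewrite ?deriv0 ?horner0; ring.
have := steinD c (steinZ m IH) h.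
congr stein; apply/funext => w; rewrite ?derivD ?derivM ?derivX ?derivC !hornerE /=; ring.
Qed.

Lemma stein_mean n g g' : stein n g g' -> EE (fun w => A (v n) w * g w) = EE g'.
Proof.
move=> [_ _ /(_ 0 0)]; rewrite BC covariance0 mul0r subr0.
under eq_Rintegral do rewrite gaussian_field0 addr0 cos0 mulr1.
by under [in X in _ = X]eq_Rintegral do rewrite gaussian_field0 addr0 cos0 mulr1.
Qed.

End gaussian_field.

(** * First chaos of white noise *)
Section white_noise_chaos.
Context {R : realType} (P : probability (Omega R) R).
Hypothesis wn : white_noise_measure P.
Local Notation Om := (Omega R).
Local Notation Rint f := (P.-integrable [set: Om] (EFin \o f)).
Local Notation EE f := (Rintegral P [set: Om] f).

(** Integration by parts is only used within the span of the Hermite functions,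
    so the field is indexed by the polynomial factor of [gauss_poly q] rather than
    by all Schwartz functions; its covariance is then [gauss_mean (q * r)]. *)
Definition gauss_schwartz (q : {poly R}) : schwartz R :=
  Sub (gauss_poly q) (schwartz_gauss_poly q).

Definition white_noise (q : {poly R}) (w : Om) : R := pairing w (gauss_schwartz q).

Definition covariance (q r : {poly R}) : R := gauss_mean (q * r).

(** Evaluation at a Schwartz function is weak-star continuous, hence Borel. *)
Lemma measurable_pairing (s : schwartz R) : measurable_fun [set: Om] (fun w => pairing w s).
Proof.
have cont : continuous (fun w : tempered_space R => (\val w) s).
  move=> w; apply: (@continuous_comp _ _ _ (fun w : tempered_space R => \val w)
     (fun f : {ptws schwartz R -> R^o} => f s)).
    exact: initial_continuous.
  exact: (@proj_continuous (schwartz R) (fun=> R^o) s).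
apply: (measurability _ (RGenOpens.measurableE R)) => _ [_ [a [b ->] <-]].
rewrite setTI; apply: sub_sigma_algebra.
have /continuousP := cont; apply.
exact: interval_open.
Qed.

Lemma white_noise_linear c q r w :
  white_noise (c *: q + r) w = c * white_noise q w + white_noise r w.
Proof.
rewrite /white_noise /pairing.
have -> : gauss_schwartz (c *: q + r) = c *: gauss_schwartz q + gauss_schwartz r.
  apply/val_inj; rewrite [RHS]linearP; apply/funext => x.
  by rewrite /= /gauss_poly hornerD hornerZ mulrDr mulrCA.
have /set_mem [lin _] := valP (w : tempered_space R).
exact: lin.
Qed.

Lemma covarianceC q r : covariance q r = covariance r q.
Proof. by rewrite /covariance mulrC. Qed.

Lemma covariance_linear c q r s :
  covariance (c *: q + r) s = c * covariance q s + covariance r s.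
Proof. by rewrite /covariance mulrDl -scalerAl gauss_meanD gauss_meanZ. Qed.

Lemma measurable_white_noise q : measurable_fun [set: Om] (white_noise q).
Proof. exact: measurable_pairing. Qed.

Lemma white_noise_char q theta : EE (fun w => cos (white_noise q w + theta)) =
  cos theta * expR (- covariance q q / 2).
Proof.
have := wn (gauss_schwartz q).
rewrite [X in expR (- X / 2)](_ : _ = covariance q q); last first.
  apply: eq_Rintegral => x _; rewrite /gauss_weighted /gauss_fun /= /gauss_poly.
  by rewrite exprMn hornerM -expr2 -expRM_natl; congr (expR _ * _); field.
move=> h.
have hc : EE (fun w => cos (white_noise q w)) = expR (- covariance q q / 2).
  have := congr1 (@complex.Re R) h; rewrite /= => <-.
  by apply: eq_Rintegral => w _; rewrite cosN.
have ic : Rint (fun w => cos (white_noise q w)).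
  apply: (@Rint_le _ _ _ P _ (fun=> 1)).
  - by apply: meas_cos; exact: measurable_white_noise.
  - by move=> w; exact: cos_max.
  - exact: finite_measure_integrable_cst.
have is_ : Rint (fun w => sin (white_noise q w)).
  apply: (@Rint_le _ _ _ P _ (fun=> 1)).
  - by apply: meas_sin; exact: measurable_white_noise.
  - by move=> w; exact: sin_max.
  - exact: finite_measure_integrable_cst.
have hs : EE (fun w => sin (white_noise q w)) = 0.
  have := congr1 (@complex.Im R) h; rewrite /= => h0.
  apply: oppr_inj; rewrite oppr0 -h0 -mulN1r -RintegralZl//.
  by apply: eq_Rintegral => w _; rewrite sinN mulN1r.
under eq_Rintegral do rewrite cosD mulrC [X in _ - X]mulrC.
rewrite RintegralB ?RintegralZl//; try exact: RintZ.
by rewrite hc hs mulr0 subr0.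
Qed.

Lemma Z_white_noise n : Z n = white_noise (hermite_factor n).
Proof.
apply/funext => w; rewrite /Z /white_noise; congr (pairing w _).
by apply/val_inj; exact: hermite_funE.
Qed.

Local Notation wn_stein := (stein P white_noise covariance (@hermite_factor R)).

Lemma all_moments_Z n : all_moments P (@Z R n).
Proof.
rewrite Z_white_noise.
exact: (all_moments_coord measurable_white_noise white_noise_linear covarianceC
  covariance_linear white_noise_char (@hermite_factor_orthonormal R)).
Qed.

Local Notation Zn := (@Z R).

Lemma wn_stein1 n : wn_stein n (fun=> 1) (fun=> 0).
Proof.
exact: (stein1 measurable_white_noise white_noise_linear covarianceC
  covariance_linear white_noise_char (@hermite_factor_orthonormal R)).
Qed.

Lemma wn_steinZ n m g g' : wn_stein n g g' ->
  wn_stein n (fun w => Zn m w * g w) (fun w => Zn m w * g' w + (n == m)%:R * g w).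
Proof.
rewrite Z_white_noise.
exact: (steinZ measurable_white_noise white_noise_linear covarianceC
  covariance_linear white_noise_char (@hermite_factor_orthonormal R)).
Qed.

Lemma wn_stein_horner n m (p : {poly R}) g g' : wn_stein n g g' ->
  wn_stein n (fun w => p.[Zn m w] * g w)
    (fun w => p.[Zn m w] * g' w + (n == m)%:R * (p^`().[Zn m w] * g w)).
Proof.
rewrite Z_white_noise.
exact: (stein_horner measurable_white_noise white_noise_linear covarianceC
  covariance_linear white_noise_char (@hermite_factor_orthonormal R)).
Qed.

Lemma wn_stein_mean n g g' : wn_stein n g g' -> EE (fun w => Zn n w * g w) = EE g'.
Proof.
rewrite Z_white_noise.
exact: (stein_mean white_noise_linear covarianceC covariance_linear).
Qed.

Lemma stein_ext n g g1 g' g1' : g =1 g1 -> g' =1 g1' ->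
  wn_stein n g g' -> wn_stein n g1 g1'.
Proof. by move=> /funext -> /funext ->. Qed.

Lemma wn_stein_prod n (r : seq nat) (b : nat -> nat) : n \notin r ->
  wn_stein n (fun w => \prod_(k <- r) (hermite_poly R (b k)).[Zn k w]) (fun=> 0).
Proof.
elim: r => [|m r IH].
  by move=> _; apply: stein_ext (wn_stein1 n) => w; rewrite ?big_nil.
rewrite inE negb_or => /andP[nm /IH h].
apply: stein_ext (wn_stein_horner m (hermite_poly R (b m)) h) => w.
  by rewrite big_cons.
by rewrite (negbTE nm) mul0r mulr0 addr0.
Qed.

(** A Hermite polynomial of positive degree in [Z_k] is orthogonal to whatever
    does not depend on [Z_k]. *)
Lemma hermite_mean0 k j g : wn_stein k g (fun=> 0) ->
  EE (fun w => (hermite_poly R j.+1).[Zn k w] * g w) = 0.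
Proof.
move=> h; have hj := wn_stein_horner k (hermite_poly R j) h.
have := wn_stein_mean hj.
have [mg mg' _] := hj.
have mZ := all_moments_Z k.
have {mg'} mg' : all_moments P (fun w => (hermite_poly R j)^`().[Zn k w] * g w).
  by apply: all_momentsM; [exact: all_moments_horner|have [] := h].
under [in X in _ = X]eq_Rintegral do rewrite eqxx mul1r mulr0 add0r.
move=> E.
under eq_Rintegral do rewrite [hermite_poly R j.+1]/= !hornerE mulrBl -mulrA.
rewrite RintegralB// ?E ?subrr//.
- by apply: all_moments_Rint; exact: all_momentsM.
- exact: all_moments_Rint.
Qed.

Lemma all_moments_Hchaos (al : mindex) : all_moments P (Hchaos al).
Proof.
apply: (@all_moments_prod _ _ _ P _ _ (fun k w => (hermite_poly R (al k)).[Zn k w])) => k.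
by apply: all_moments_horner; exact: all_moments_Z.
Qed.

Lemma HchaosE (al : mindex) k w : Hchaos al w =
  (hermite_poly R (al k)).[Zn k w] *
  \prod_(m <- rem k (finsupp al)) (hermite_poly R (al m)).[Zn m w].
Proof.
rewrite /Hchaos; have [kal|kal] := boolP (k \in finsupp al).
  by rewrite (perm_big _ (perm_to_rem kal)) big_cons.
rewrite rem_id//; move: (kal); rewrite memNfinsupp => /eqP ->.
by rewrite /= hornerC mul1r.
Qed.

(** [Z_n] is orthogonal to every [H_al] except [H_(e_n) = Z_n]. If [al] charges
    some [k] other than [n], the factor of [H_al] in [Z_k] kills the mean; otherwise
    [H_al] is a Hermite polynomial in [Z_n] and integration by parts lowers it. *)
Lemma mean_Z_Hchaos n (al : mindex) :
  EE (fun w => Zn n w * Hchaos al w) = (al == unit_index n)%:R.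
Proof.
have unif (k : nat) : k \notin rem k (finsupp al).
  by rewrite mem_rem_uniq ?fset_uniq// !inE eqxx.
have [/existsNP [k /not_implyP [kn /eqP alk]]|only_n] :=
    pselect (~ forall k, k <> n -> al k = 0%N); last first.
  have {}only_n k : k <> n -> al k = 0%N by move/contrapT: only_n; exact.
  have HE w : Hchaos al w = (hermite_poly R (al n)).[Zn n w].
    rewrite (HchaosE al n) big_seq big1 ?mulr1// => m.
    rewrite mem_rem_uniq ?fset_uniq// !inE => /andP[/eqP mn _].
    by rewrite only_n//= hornerC.
  have alE : (al == unit_index n) = (al n == 1%N).
    apply/eqP/eqP => [->|al1]; first by rewrite unit_indexE eqxx.
    apply/fsfunP => k; rewrite unit_indexE; case: eqP => [->//|kn].
    exact: only_n.
  under eq_Rintegral do rewrite HE.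
  have S := wn_stein_horner n (hermite_poly R (al n)) (wn_stein1 n).
  have := wn_stein_mean S.
  under eq_Rintegral do rewrite mulr1.
  under [in X in _ = X]eq_Rintegral do rewrite eqxx mulr0 add0r mul1r mulr1.
  move=> ->; rewrite alE.
  case: (al n) => [|[|j]].
  - under eq_Rintegral do rewrite /= derivC horner0.
    by rewrite probability_Rintegral_cst.
  - under eq_Rintegral do rewrite deriv_hermite scale1r /= hornerC.
    by rewrite probability_Rintegral_cst.
  - under eq_Rintegral do rewrite deriv_hermite hornerZ.
    rewrite RintegralZl//; last first.
      by apply: all_moments_Rint; apply: all_moments_horner; exact: all_moments_Z.
    have := hermite_mean0 j (wn_stein1 n).
    under eq_Rintegral do rewrite mulr1.
    by move=> ->; rewrite mulr0.
have -> : (al == unit_index n) = false.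
  apply/eqP => E; move: alk; by rewrite E unit_indexE; move/eqP/negbTE : kn => ->.
have S := wn_steinZ n (wn_stein_prod al (unif k)).
have S0 : wn_stein k (fun w => Zn n w *
   \prod_(m <- rem k (finsupp al)) (hermite_poly R (al m)).[Zn m w]) (fun=> 0).
  apply: stein_ext S => // w; case: eqP => [//|_].
  by rewrite mul0r mulr0 addr0.
case: (al k) alk (HchaosE al k) => // j _ HE.
rewrite -[RHS](hermite_mean0 j S0); apply: eq_Rintegral => w _.
by rewrite HE mulrCA.
Qed.

Lemma mfact_unit_index n : mfact (unit_index n) = 1%N.
Proof.
rewrite /mfact big_seq big1// => k; rewrite mem_finsupp_unit => /eqP ->.
by rewrite unit_indexE eqxx.
Qed.

(** Means against a fixed square-integrable [h] pass to limits in L2, by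
    [|x y| <= (kappa x^2 + y^2 / kappa) / 2] with a large [kappa]. *)
Lemma L2_mean_limit (s : nat -> Om -> R) (f h : Om -> R) (L : R) (N1 : nat) :
  (forall N, all_moments P (s N)) -> measurable_fun [set: Om] f ->
  Rint (fun w => f w ^+ 2) -> all_moments P h ->
  (forall e : R, 0 < e -> exists2 N, (N1 <= N)%N &
     Rint (fun w => (s N w - f w) ^+ 2) /\ EE (fun w => (s N w - f w) ^+ 2) <= e) ->
  (forall N, (N1 <= N)%N -> EE (fun w => s N w * h w) = L) ->
  EE (fun w => f w * h w) = L.
Proof.
move=> ms mf if2 mh lim sL.
have ih2 : Rint (fun w => h w ^+ 2) by have [_ /(_ 1%N)] := mh.
have ifh : Rint (fun w => f w * h w).
  apply: (@Rint_le _ _ _ P _ (fun w => f w ^+ 2 + h w ^+ 2)); last exact: RintD.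
    by apply: measurable_funM => //; have [] := mh.
  move=> w; rewrite normrM -[f w ^+ 2]real_normK ?num_real// -[h w ^+ 2]real_normK ?num_real//.
  by have := sqr_ge0 (`|f w| - `|h w|); have := sqr_ge0 (`|f w|); have := sqr_ge0 (`|h w|); nra.
pose M := EE (fun w => h w ^+ 2).
have M0 : 0 <= M by apply: Rintegral_ge0 => w _; exact: sqr_ge0.
apply/eqP; rewrite -subr_eq0 -normr_eq0 eq_le normr_ge0 andbT.
apply/ler_addgt0Pr => e e0; rewrite add0r.
pose kappa := M / e + 1.
have k0 : 0 < kappa by rewrite ltr_wpDl// divr_ge0// ltW.
have [N NN1 [iN hN]] := lim (e / kappa) (divr_gt0 e0 k0).
have ish : Rint (fun w => s N w * h w) by apply: all_moments_Rint; exact: all_momentsM.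
rewrite -(sL N NN1) distrC -RintegralB//.
have iB : Rint (fun w => s N w * h w - f w * h w) by exact: RintB.
apply: le_trans (le_normr_Rintegral measurableT iB) _.
have i2 : Rint (fun w => kappa / 2 * (s N w - f w) ^+ 2 + (2 * kappa)^-1 * h w ^+ 2).
  by apply: RintD; exact: RintZ.
apply: (@le_trans _ _ (EE (fun w => kappa / 2 * (s N w - f w) ^+ 2 + (2 * kappa)^-1 * h w ^+ 2))).
  apply: le_Rintegral => //; first exact: integrable_norm.
  move=> w _; rewrite -mulrBl normrM.
  rewrite -[(_ - _) ^+ 2]real_normK ?num_real// -[h w ^+ 2]real_normK ?num_real//.
  move: `|_ - _| `|h w| => x y.
  have -> : kappa / 2 * x ^+ 2 + (2 * kappa)^-1 * y ^+ 2 =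
     x * y + (kappa * x - y) ^+ 2 / (2 * kappa) by field; rewrite gt_eqF.
  by rewrite lerDl divr_ge0 ?sqr_ge0// mulr_ge0// ltW.
rewrite RintegralD//; try exact: RintZ.
rewrite !RintegralZl//.
have h1 : kappa / 2 * EE (fun w => (s N w - f w) ^+ 2) <= e / 2.
  apply: (@le_trans _ _ (kappa / 2 * (e / kappa))).
    by rewrite ler_wpM2l// divr_ge0// ltW.
  by rewrite mulrACA (mulrC kappa) mulrACA divff ?gt_eqF// mulr1 mulrC.
have h2 : (2 * kappa)^-1 * M <= e / 2.
  rewrite ler_pdivrMl ?mulr_gt0//.
  have -> : 2 * kappa * (e / 2) = M + e by rewrite /kappa; field; rewrite gt_eqF.
  by rewrite lerDl ltW.
by rewrite [leRHS]splitr; exact: lerD.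
Qed.

Lemma sum_coef_Hchaos (c : nat -> R) (al : mindex) (N : nat) :
  EE (fun w => (\sum_(n < N) c n * Zn n w) * Hchaos al w) =
  \sum_(n < N) c n * (al == unit_index n)%:R.
Proof.
have mZ n : Rint (fun w => Zn n w * Hchaos al w).
  by apply: all_moments_Rint; apply: all_momentsM; [exact: all_moments_Z|exact: all_moments_Hchaos].
elim: N => [|N IH].
  under eq_Rintegral do rewrite big_ord0 mul0r.
  by rewrite big_ord0 probability_Rintegral_cst.
under eq_Rintegral do rewrite big_ord_recr /= mulrDl -mulrA.
rewrite RintegralD//; last exact: RintZ.
  by rewrite big_ord_recr /= IH RintegralZl// mean_Z_Hchaos.
elim: N {IH} => [|N IH].
  by under eq_fun do rewrite big_ord0 mul0r; exact: finite_measure_integrable_cst.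
under eq_fun do rewrite big_ord_recr /= mulrDl -mulrA.
by apply: RintD => //; exact: RintZ.
Qed.

Lemma all_moments_sumZ (c : nat -> R) N : all_moments P (fun w => \sum_(n < N) c n * Zn n w).
Proof.
elim: N => [|N IH].
  by under eq_fun do rewrite big_ord0; exact: all_moments_cst.
under eq_fun do rewrite big_ord_recr /=.
by apply: all_momentsD => //; apply: all_momentsM; [exact: all_moments_cst|exact: all_moments_Z].
Qed.

Lemma Rint_normc2 (F : Om -> R[i]) :
  measurable_fun [set: Om] (fun w => complex.Re (F w)) ->
  measurable_fun [set: Om] (fun w => complex.Im (F w)) ->
  (normL2sq P F < +oo)%E -> Rint (fun w => normc (F w) ^+ 2).
Proof.
move=> mRe mIm fin; apply/integrableP; split.
  apply/measurable_EFinP; under eq_fun do rewrite normc_sq.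
  by apply: measurable_funD; exact: measurable_funX.
apply: le_lt_trans fin; rewrite le_eqVlt; apply/orP; left; apply/eqP.
by apply: eq_integral => w _ /=; rewrite ger0_norm// sqr_ge0.
Qed.

Lemma Re_sumZ (c : nat -> R[i]) N w : complex.Re (\sum_(n < N) c n * (Zn n w)%:C%C) =
  \sum_(n < N) complex.Re (c n) * Zn n w.
Proof. by rewrite (raddf_sum (@complex.Re R)) /=; apply: eq_bigr => n _; rewrite Re_mul /= mulr0 subr0. Qed.

Lemma Im_sumZ (c : nat -> R[i]) N w : complex.Im (\sum_(n < N) c n * (Zn n w)%:C%C) =
  \sum_(n < N) complex.Im (c n) * Zn n w.
Proof. by rewrite (raddf_sum (@complex.Im R)) /=; apply: eq_bigr => n _; rewrite Im_mul /= mulr0 add0r. Qed.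

(** Each coefficient is a mean against some [H_al]; it is constant along the
    partial sums once they contain the term that matters, and passes to the L2
    limit. *)
Lemma chaos_series_linear (c : nat -> R[i]) (F : Om -> R[i]) :
  cvgL2 P (fun N w => \sum_(n < N) c n * (Zn n w)%:C%C) F ->
  chaos_series P F = linear_series c.
Proof.
move=> [[mRe mIm fin] cv]; apply/funext => al.
pose S N w := \sum_(n < N) c n * (Zn n w)%:C%C.
have iF2 := Rint_normc2 mRe mIm fin.
pose lin (a : nat -> R) := \sum_(n <- finsupp al) (if al == unit_index n then a n else 0).
have [N1 hN1] : exists N1, forall (a : nat -> R) N, (N1 <= N)%N ->
    \sum_(n < N) a n * (al == unit_index n)%:R = lin a.
  have [[m alm]|no] := pselect (exists m, al = unit_index m); last first.
    have no' n : (al == unit_index n) = false by apply/eqP => E; apply: no; exists n.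
    exists 0%N => a N _; rewrite /lin !big1// => n _; rewrite no'//.
    by rewrite mulr0.
  exists m.+1 => a N mN.
  rewrite (bigD1 (Ordinal mN))//= alm eqxx mulr1 big1 ?addr0 => [|n nm]; last first.
    case: eqP => [/unit_index_inj E|_]; last by rewrite mulr0.
    by move: nm; rewrite -val_eqE /= E eqxx.
  rewrite /lin alm (big_fsetD1 m) ?mem_finsupp_unit//= eqxx big_seq big1 ?addr0// => n.
  by rewrite !inE mem_finsupp_unit => /andP[/negbTE ->].
have near (e : R) : 0 < e -> exists2 N, (N1 <= N)%N &
    Rint (fun w => normc (S N w - F w) ^+ 2) /\ EE (fun w => normc (S N w - F w) ^+ 2) <= e.
  move=> e0; have := cv; move=> /fine_cvgP [finN /cvgrPdist_le /(_ e e0) cvN].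
  have [N [NN1 NF Ne]] : exists N, [/\ (N1 <= N)%N,
      normL2sq P (fun w => S N w - F w) \is a fin_num &
      `|0 - fine (normL2sq P (fun w => S N w - F w))| <= e].
    have h3 : \forall N \near \oo, (N1 <= N)%N by exact: nbhs_infty_ge.
    have [N [[? ?] ?]] := filter_ex (filterI (filterI h3 finN) cvN).
    by exists N.
  exists N => //; split; last first.
    by apply: le_trans Ne; rewrite sub0r normrN; exact: ler_norm.
  apply: Rint_normc2.
  - under eq_fun do rewrite raddfB /= Re_sumZ.
    by apply: measurable_funB => //; have [] := all_moments_sumZ (fun n => complex.Re (c n)) N.
  - under eq_fun do rewrite raddfB /= Im_sumZ.
    by apply: measurable_funB => //; have [] := all_moments_sumZ (fun n => complex.Im (c n)) N.
  - by rewrite ltey_eq NF.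
have hRe : EE (fun w => complex.Re (F w) * Hchaos al w) =
    lin (fun n => complex.Re (c n)).
  apply: (@L2_mean_limit (fun N w => \sum_(n < N) complex.Re (c n) * Zn n w) _ _ _ N1).
  - by move=> N; exact: (all_moments_sumZ (fun n => complex.Re (c n)) N).
  - exact: mRe.
  - apply: (@Rint_le _ _ _ P _ (fun w => normc (F w) ^+ 2)) => //; first exact: measurable_funX.
    by move=> w; rewrite normc_sq ger0_norm ?sqr_ge0// lerDl sqr_ge0.
  - exact: all_moments_Hchaos.
  - move=> e e0; have [N NN1 [iN hN]] := near e e0; exists N => //.
    have le1 w : (\sum_(n < N) complex.Re (c n) * Zn n w - complex.Re (F w)) ^+ 2 <=
       normc (S N w - F w) ^+ 2.
      by rewrite normc_sq -Re_sumZ -raddfB lerDl sqr_ge0.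
    have i1 : Rint (fun w => (\sum_(n < N) complex.Re (c n) * Zn n w - complex.Re (F w)) ^+ 2).
      apply: (@Rint_le _ _ _ P _ (fun w => normc (S N w - F w) ^+ 2)) => //.
        apply: measurable_funX; apply: measurable_funB => //.
        by have [] := all_moments_sumZ (fun n => complex.Re (c n)) N.
      by move=> w; rewrite ger0_norm ?sqr_ge0.
    by split => //; apply: le_trans hN; exact: le_Rintegral.
  - by move=> N NN1; rewrite (sum_coef_Hchaos (fun n => complex.Re (c n))) (hN1 (fun n => complex.Re (c n))).
have hIm : EE (fun w => complex.Im (F w) * Hchaos al w) =
    lin (fun n => complex.Im (c n)).
  apply: (@L2_mean_limit (fun N w => \sum_(n < N) complex.Im (c n) * Zn n w) _ _ _ N1).
  - by move=> N; exact: (all_moments_sumZ (fun n => complex.Im (c n)) N).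
  - exact: mIm.
  - apply: (@Rint_le _ _ _ P _ (fun w => normc (F w) ^+ 2)) => //; first exact: measurable_funX.
    by move=> w; rewrite normc_sq ger0_norm ?sqr_ge0// lerDr sqr_ge0.
  - exact: all_moments_Hchaos.
  - move=> e e0; have [N NN1 [iN hN]] := near e e0; exists N => //.
    have le1 w : (\sum_(n < N) complex.Im (c n) * Zn n w - complex.Im (F w)) ^+ 2 <=
       normc (S N w - F w) ^+ 2.
      by rewrite normc_sq -Im_sumZ -raddfB lerDr sqr_ge0.
    have i1 : Rint (fun w => (\sum_(n < N) complex.Im (c n) * Zn n w - complex.Im (F w)) ^+ 2).
      apply: (@Rint_le _ _ _ P _ (fun w => normc (S N w - F w) ^+ 2)) => //.
        apply: measurable_funX; apply: measurable_funB => //.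
        by have [] := all_moments_sumZ (fun n => complex.Im (c n)) N.
      by move=> w; rewrite ger0_norm ?sqr_ge0.
    by split => //; apply: le_trans hN; exact: le_Rintegral.
  - by move=> N NN1; rewrite (sum_coef_Hchaos (fun n => complex.Im (c n))) (hN1 (fun n => complex.Im (c n))).
rewrite /chaos_series /Cintegral.
under eq_Rintegral do rewrite Re_mul /= mulr0 subr0.
under [in X in (_ +i* X)%C]eq_Rintegral do rewrite Im_mul /= mulr0 add0r.
rewrite hRe hIm.
have -> : (lin (fun n => complex.Re (c n)) +i* lin (fun n => complex.Im (c n)))%C =
   linear_series c al.
  rewrite [RHS]complex_eta (raddf_sum (@complex.Re R)) (raddf_sum (@complex.Im R)) /=.
  by congr (_ +i* _)%C; apply: eq_bigr => n _; case: ifP.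
have [[m ->]|no] := pselect (exists m, al = unit_index m).
  by rewrite mfact_unit_index divr1.
rewrite linear_series0 ?mul0r// => n.
by apply/eqP => E; apply: no; exists n.
Qed.

End white_noise_chaos.

(** * Riemann sums of paths of formal series *)
Section riemann_sums.
Context {R : realType}.
Local Notation fseries := (@fseries R).
Implicit Types (p : nat) (s : seq R).

Lemma node_size a b s : itv_partition a b s -> node a s (size s) = b.
Proof. by move=> [_ /eqP <-]; rewrite /node -[size s]/((size (a :: s)).-1) nth_last. Qed.

Lemma node_lt a b s k : itv_partition a b s -> (k < size s)%N ->
  node a s k < node a s k.+1.
Proof. by move=> [/pathP h _] ks; rewrite /node /=; exact: h. Qed.

Lemma node_le a b s i j : itv_partition a b s -> (i <= j)%N -> (j <= size s)%N ->
  node a s i <= node a s j.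
Proof.
move=> h; elim: j => [|j IH]; first by rewrite leqn0 => /eqP ->.
rewrite leq_eqVlt => /predU1P[->//|ij] js.
by apply: le_trans (IH ij (ltnW js)) _; apply/ltW/(node_lt h).
Qed.

Lemma node_in a b s k : itv_partition a b s -> (k <= size s)%N ->
  node a s k \in `[a, b].
Proof.
move=> h ks; rewrite in_itv /= -[X in X <= _ <= _]/(node a s 0) -(node_size h).
by rewrite !(node_le h).
Qed.

Lemma node_mesh a s k : (k < size s)%N -> node a s k.+1 - node a s k <= mesh a s.
Proof.
by move=> ks; rewrite /mesh; apply: (@le_bigmax_cond _ _ _ 0 (Ordinal ks) xpredT
  (fun k : 'I_(size s) => node a s k.+1 - node a s k)).
Qed.

Lemma sum_node (V : zmodType) (f : R -> V) a b s : itv_partition a b s ->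
  \sum_(k < size s) (f (node a s k.+1) - f (node a s k)) = f b - f a.
Proof.
move=> h; rewrite -(big_mkord xpredT (fun k => f (node a s k.+1) - f (node a s k))).
by rewrite telescope_sumr// (node_size h).
Qed.

(** The mean value inequality on each interval of the partition, summed. *)
Lemma dnorm_le_riemann_sum p (G F : R -> fseries) (v : nat -> fseries) a b s e :
  0 <= e -> itv_partition a b s ->
  (forall al x, x \in `[a, b] ->
     is_derive x (1 : R) (fun y => complex.Re (G y al)) (complex.Re (F x al))) ->
  (forall al x, x \in `[a, b] ->
     is_derive x (1 : R) (fun y => complex.Im (G y al)) (complex.Im (F x al))) ->
  (forall k x, (k < size s)%N -> node a s k <= x <= node a s k.+1 ->
     dnorm_le p (F x - v k) e) ->
  dnorm_le p (\sum_(k < size s)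
     (fun al => (node a s k.+1 - node a s k)%:C%C * v k al) - (G b - G a)) (e * (b - a)).
Proof.
move=> e0 h dRe dIm hv.
rewrite -(sum_node G h) -(sum_node id h) mulr_sumr -sumrB.
have D0 (k : 'I_(size s)) : 0 <= node a s k.+1 - node a s k.
  by rewrite subr_ge0; apply/ltW/(node_lt h).
apply: dnorm_le_sum => [k|k]; first by rewrite mulr_ge0.
rewrite -opprB; apply: dnorm_leN.
have sub x : x \in `[node a s k, node a s k.+1] -> x \in `[a, b].
  have := node_in h (ltnW (ltn_ord k)); have := node_in h (ltn_ord k).
  rewrite !in_itv /= => /andP[_ h1] /andP[h2 _] /andP[h3 h4].
  by rewrite (le_trans h2 h3) (le_trans h4 h1).
have le_node : node a s k <= node a s k.+1 by rewrite -subr_ge0.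
have K := @dnorm_le_increment R p G F (v k) _ _ e le_node e0
  (fun al x xk => dRe al x (sub x xk)) (fun al x xk => dIm al x (sub x xk)).
have /K {}K x : x \in `[node a s k, node a s k.+1] -> dnorm_le p (F x - v k) e.
  by rewrite in_itv /= => xk; exact: hv.
rewrite [X in dnorm_le p X]( _ : _ = G (node a s k.+1) - G (node a s k) -
  (fun al : mindex => (node a s k.+1 - node a s k)%:C%C * v k al)).
  exact: K.
by apply/funext => al; reflexivity.
Qed.

End riemann_sums.

(** * The Wick integral *)
Section wick_integral.
Context {R : realType}.
Local Notation fseries := (@fseries R).

(** The three estimates on [V] and [U] say that [V] is bounded and Lipschitz and
    is the derivative of [U], with a quadratic error. Wick products with series of
    degree one being bounded, [Y * V] is uniformly continuous in norm, hence has a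
    primitive whose increment is the integral; and replacing [V t_k dt] by the
    increment of [U] in a Riemann sum costs only [M * mesh * (b - a)]. *)
Lemma wick_integral p (Y V U : R -> fseries) a b M :
  (1 < p)%N -> 0 <= M -> a < b ->
  (forall t, degree_one (V t)) -> (forall t, degree_one (U t)) ->
  (forall t, t \in `[a, b] -> dnorm_le p (Y t) M) ->
  (forall e, 0 < e -> exists2 delta, 0 < delta & forall s t, s \in `[a, b] ->
     t \in `[a, b] -> `|s - t| < delta -> dnorm_le p (Y s - Y t) e) ->
  (forall t, dnorm_le 0 (V t) 1) ->
  (forall s t, dnorm_le 0 (V t - V s) `|t - s|) ->
  (forall s t, s <= t -> dnorm_le 0 (U t - U s - (fun al => (t - s)%:C%C * V s al))
                                    ((t - s) * (t - s))) ->
  exists I : fseries,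
    [/\ in_Hdual p I,
        is_Riemann_integral p (fun t => wick (Y t) (V t)) a b I &
        is_mesh_limit p a b (fun s => \sum_(k < size s)
          wick (Y (node a s k)) (U (node a s k.+1) - U (node a s k))) I].
Proof.
move=> p1 M0 ab V1 U1 YM Yuc V_le V_lip U_lin.
pose F t := wick (Y t) (V t).
have FB x y : F x - F y = wick (Y x - Y y) (V x) + wick (Y y) (V x - V y).
  by rewrite wickBl// wickBr// addrA subrK.
have F_le t : t \in `[a, b] -> dnorm_le p (F t) M.
  by move=> tab; rewrite -[M]mulr1; apply: dnorm_le_wick => //; exact: YM.
have Fuc e : 0 < e -> exists2 delta, 0 < delta & forall x y, x \in `[a, b] ->
    y \in `[a, b] -> `|x - y| < delta -> dnorm_le p (F x - F y) e.
  move=> e0; have e2 : 0 < e / 2 by rewrite divr_gt0.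
  have [d d0 hd] := Yuc _ e2.
  have M1 : 0 < M + 1 by rewrite ltr_wpDl.
  exists (Num.min d (e / 2 / (M + 1))); first by rewrite lt_min d0 divr_gt0.
  move=> x y xab yab; rewrite lt_min => /andP[xyd xyM].
  apply: (@dnorm_le_mono _ _ _ (e / 2 * 1 + M * `|x - y|)).
  - by rewrite addr_ge0// mulr_ge0// ltW.
  - have : M * `|x - y| <= e / 2.
      rewrite (@le_trans _ _ ((M + 1) * `|x - y|))//.
        by rewrite ler_wpM2r// lerDl.
      by rewrite mulrC -ler_pdivlMr// ltW.
    by lra.
  - rewrite FB; apply: dnorm_leD.
    + by rewrite mulr_ge0// ltW.
    + by rewrite mulr_ge0.
    + by apply: dnorm_le_wick => //; exact: hd.
    + by apply: dnorm_le_wick => //; [exact: degree_oneB|exact: YM].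
(* extending [F] by constants outside [a, b] makes its coordinates continuous on
   the whole line *)
pose cl t := Num.max a (Num.min t b).
have cl_in t : cl t \in `[a, b].
  by rewrite in_itv /= /cl le_max lexx /= ge_max (ltW ab) ge_min lexx orbT.
have clE t : t \in `[a, b] -> cl t = t.
  by rewrite in_itv /= => /andP[h1 h2]; rewrite /cl (min_l h2) (max_r h1).
have Fco al e : 0 < e -> exists2 delta, 0 < delta & forall x y, `|x - y| < delta ->
    normc (F (cl x) al - F (cl y) al) < e.
  move=> e0; pose w := Num.sqrt (weight (R:=R) p al).
  have w0 : 0 < w by rewrite sqrtr_gt0 weight_gt0.
  have [d d0 hd] := Fuc (e / 2 * w) (mulr_gt0 (divr_gt0 e0 (ltr0Sn _ 1)) w0).
  exists d => // x y xy.
  have := dnorm_le_coord al _ (hd _ _ (cl_in x) (cl_in y) (le_lt_trans (clamp_lipschitz _ _ _ _) xy)).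
  rewrite fseriesDE ler_pM2r// => h.
  apply: le_lt_trans (h _) _; first by rewrite mulr_ge0// ltW// divr_gt0.
  by lra.
have Fco_Re al : continuous (fun t => complex.Re (F (cl t) al)).
  move=> x; apply/cvgrPdist_lt => e e0; have [d d0 hd] := Fco al e e0.
  near=> y; rewrite -raddfB; apply: le_lt_trans (normc_ge_Re _) _.
  apply: hd; near: y; exact: cvgr_dist_lt.
have Fco_Im al : continuous (fun t => complex.Im (F (cl t) al)).
  move=> x; apply/cvgrPdist_lt => e e0; have [d d0 hd] := Fco al e e0.
  near=> y; rewrite -raddfB; apply: le_lt_trans (normc_ge_Im _) _.
  apply: hd; near: y; exact: cvgr_dist_lt.
have /choice [g hg] := fun al => exists_Cprimitive (a - 1) (Fco_Re al) (Fco_Im al).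
pose G t : fseries := fun al => g al t.
have a1 x : x \in `[a, b] -> a - 1 < x.
  by rewrite in_itv /= => /andP[h _]; apply: lt_le_trans h; rewrite ltrBlDr ltrDl.
have dRe al x : x \in `[a, b] ->
    is_derive x (1 : R) (fun y => complex.Re (G y al)) (complex.Re (F x al)).
  by move=> xab; have [h _ _] := hg al; rewrite -{2}(clE x xab); apply: h; exact: a1.
have dIm al x : x \in `[a, b] ->
    is_derive x (1 : R) (fun y => complex.Im (G y al)) (complex.Im (F x al)).
  by move=> xab; have [_ h _] := hg al; rewrite -{2}(clE x xab); apply: h; exact: a1.
have ba : 0 < b - a by rewrite subr_gt0.
have near_node s k x y : itv_partition a b s -> (k < size s)%N ->
    node a s k <= x <= node a s k.+1 -> node a s k <= y <= node a s k.+1 ->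
    [/\ x \in `[a, b], y \in `[a, b] & `|x - y| <= mesh a s].
  move=> h ks /andP[x1 x2] /andP[y1 y2].
  have := node_in h (ltnW ks); have := node_in h ks; have := node_mesh a ks.
  rewrite !in_itv /= => m /andP[_ h1] /andP[h2 _].
  split; [lra|lra|rewrite ler_norml; apply/andP; split; lra].
have riemann e : 0 < e -> exists2 delta, 0 < delta & forall s (xi : nat -> R),
    itv_partition a b s -> mesh a s < delta ->
    (forall k, (k < size s)%N -> node a s k <= xi k <= node a s k.+1) ->
    dnorm_le p (\sum_(k < size s) (fun al =>
      (node a s k.+1 - node a s k)%:C%C * F (xi k) al) - (G b - G a)) e.
  move=> e0; have eb : 0 < e / (b - a) by rewrite divr_gt0.
  have [d d0 hd] := Fuc _ eb; exists d => // s xi h ms xik.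
  rewrite -[e](divfK (lt0r_neq0 ba)).
  apply: (dnorm_le_riemann_sum (F := F) (v := F \o xi)) => //; first exact: ltW.
  move=> k x ks xk; have [h1 h2 h3] := near_node s k x (xi k) h ks xk (xik k ks).
  by apply: hd => //; exact: le_lt_trans h3 ms.
exists (G b - G a); split.
- apply: (@dnorm_le_in_Hdual _ _ _ (M * (b - a))).
  have := @dnorm_le_increment R p G F 0 a b M (ltW ab) M0.
  rewrite (_ : (fun al => _ * (0 : fseries) al) = 0) ?subr0; last first.
    by apply/funext => al; rewrite mulr0.
  by move=> /(_ dRe dIm); apply=> x xab; rewrite subr0; exact: F_le.
- move=> e e0; have e2 : 0 < e / 2 by rewrite divr_gt0.
  have [d d0 hd] := riemann _ e2; exists d => // s xi h ms xik.
  apply: (@le_lt_trans _ _ ((e / 2) ^+ 2)%:E).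
    by apply/dual_normsq_le; exact: (hd s xi).
  by rewrite lte_fin; nra.
- move=> e e0; have e3 : 0 < e / 3 by rewrite divr_gt0.
  have [d d0 hd] := riemann _ e3.
  have M1 : 0 < M * (b - a) + 1 by rewrite ltr_wpDl// mulr_ge0// ltW.
  exists (Num.min d (e / 3 / (M * (b - a) + 1))); first by rewrite lt_min d0 divr_gt0.
  move=> s h; rewrite lt_min => /andP[ms1 ms2].
  have m0 : 0 <= mesh a s by rewrite /mesh bigmax_idl le_max lexx.
  apply: (@le_lt_trans _ _ ((e / 3 + e / 3) ^+ 2)%:E); last by rewrite lte_fin; nra.
  apply/dual_normsq_le.
  have le_node k : (k < size s)%N -> node a s k <= node a s k.+1.
    by move=> ks; apply/ltW/(node_lt h).
  have split_sum : \sum_(k < size s)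
        wick (Y (node a s k)) (U (node a s k.+1) - U (node a s k)) - (G b - G a) =
      \sum_(k < size s) wick (Y (node a s k)) (U (node a s k.+1) - U (node a s k) -
         (fun al => (node a s k.+1 - node a s k)%:C%C * V (node a s k) al)) +
      (\sum_(k < size s) (fun al =>
         (node a s k.+1 - node a s k)%:C%C * F (node a s k) al) - (G b - G a)).
    rewrite addrA -big_split /=; congr (_ - _); apply: eq_bigr => k _.
    have dU : degree_one (U (node a s k.+1) - U (node a s k)) by exact: degree_oneB.
    by rewrite (wickBr _ dU (degree_oneZ (V1 _))) wickZr ?subrK.
  rewrite split_sum; apply: dnorm_leD; [exact: ltW|exact: ltW| |]; last first.
    by apply: hd => // k ks; rewrite lexx le_node.
  apply: (@dnorm_le_mono _ _ _ (\sum_(k < size s)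
      M * ((node a s k.+1 - node a s k) * mesh a s))).
  - by apply: sumr_ge0 => k _; rewrite !mulr_ge0// subr_ge0 le_node.
  - rewrite -mulr_sumr -mulr_suml (sum_node id h) /=.
    have : mesh a s * (M * (b - a) + 1) <= e / 3 by rewrite -ler_pdivlMr// ltW.
    by nra.
  apply: dnorm_le_sum => [k|k]; first by rewrite !mulr_ge0// subr_ge0 le_node.
  apply: dnorm_le_wick => //.
  - by apply: degree_oneB; [exact: degree_oneB|exact: degree_oneZ].
  - by apply: YM; exact: node_in h (ltnW (ltn_ord k)).
  - apply: dnorm_le_mono (U_lin _ _ (le_node _ _)) => //.
    + by rewrite mulr_ge0// subr_ge0 le_node.
    + by rewrite ler_wpM2l ?subr_ge0 ?le_node// node_mesh.
Unshelve. all: by end_near.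
Qed.

End wick_integral.
Theorem theorem7p1 (R : realType)
    (sigma : probability (measurableTypeR R) R) (lam : nat -> R)
    (P : probability (Omega R) R)
    (X W : R -> Omega R -> R[i])
    (a b : R) (Y : R -> @fseries R) :
  symmetric_measure sigma ->
  supported_in sigma `[- 2^-1, 2^-1] ->
  injective lam ->
  lam 0%N = 0 ->
  (forall n, exists m : nat, lam n = pi * m%:R) ->
  orthonormal_basisL2 sigma (fun n u => expi (lam n * u)) ->
  white_noise_measure P ->
  is_Xsigma sigma lam P X ->
  is_Wsigma sigma lam P W ->
  a < b ->
  (forall t, t \in `[a, b] -> Sm1 (Y t)) ->
  {within `[a, b], continuous (fun t => strong_dual (Y t))} ->
  exists p : nat,
    [/\ (0 < p)%N,
        forall t, t \in `[a, b] ->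
          in_Hdual p (wick (Y t) (chaos_series P (W t))) &
        exists I : @fseries R,
          [/\ in_Hdual p I,
              is_Riemann_integral p
                (fun t => wick (Y t) (chaos_series P (W t))) a b I &
              is_mesh_limit p a b
                (fun s => \sum_(k < size s)
                   wick (Y (node a s k))
                        (chaos_series P (X (node a s k.+1))
                         - chaos_series P (X (node a s k)))) I]].
Proof.
move=> _ supp _ lam0 _ onb wn hX hW ab YS Yc.
have [k [M [M0 YM]]] := strong_continuous_bounded YS Yc.
have Yuc := strong_continuous_uniform Yc M0 YM.
(* [k.+1] for the norm continuity of the path, and at least [2] for the products *)
exists k.+2.
have WE t : chaos_series P (W t) = W_coef sigma lam t := chaos_series_linear wn (hW t).
have XE t : chaos_series P (X t) = X_coef sigma lam t := chaos_series_linear wn (hX t).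
have YM2 t : t \in `[a, b] -> dnorm_le k.+2 (Y t) M.
  by move=> /YM /dnorm_le_succ/dnorm_le_succ.
have [] := @wick_integral _ k.+2 Y (W_coef sigma lam) (X_coef sigma lam) a b M
  isT M0 ab (fun t => @linear_series_degree_one _ _) (fun t => @linear_series_degree_one _ _)
  YM2 _ (dnorm_W_coef onb) (fun s t => dnorm_W_coefB supp onb t s)
  (fun s t => @dnorm_X_coef_linearization _ _ _ supp lam0 onb s t).
  move=> e /Yuc[d d0 hd]; exists d => // s t sab tab st.
  by apply: dnorm_le_succ; exact: hd.
move=> I [HI RI LI]; split => // [t tab|].
  rewrite WE; apply: (@dnorm_le_in_Hdual _ _ _ (M * 1)).
  by apply: dnorm_le_wick; [|exact: linear_series_degree_one|exact: YM2|exact: dnorm_W_coef onb t].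
exists I; split => //.
  by rewrite (_ : (fun t => _) = fun t => wick (Y t) (W_coef sigma lam t))//; apply/funext => t; rewrite WE.
rewrite (_ : (fun s => _) = fun s => \sum_(k < size s) wick (Y (node a s k))
  (X_coef sigma lam (node a s k.+1) - X_coef sigma lam (node a s k)))//.
by apply/funext => s; apply: eq_bigr => i _; rewrite !XE.
Qed.
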